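(* Let $\{w_i\}_{i=1}^n$ be a basis of $\mathbb{R}^n$, let $m\geqslant1$ and let $(S_1,\dots,S_m)$ be a uniform cover of $[n]$ with weights $(p_1,\dots,p_m)$. Let $H_j=\mathrm{span}\{w_k : k\in S_j\}$ and put $$BL_2:=\frac{\prod_{j=1}^m|\wedge_{k\in S_j}w_k|^{p_j}}{|\wedge_{i=1}^n w_i|}.$$ Then for all integrable functions $f_j:H_j\to[0,\infty)$, $1\leqslant j\leqslant m$, $$\int_{\mathbb{R}^n}\prod_{j=1}^m f_j^{p_j}(P_{H_j}x)\,dx\leqslant BL_2\prod_{j=1}^m\left(\int_{H_j}f_j(x)\,dx\right)^{p_j}.$$ Moreover, for every integrable $f:\mathbb{R}^n\to[0,\infty)$ and integrable $f_j:H_j\to[0,\infty)$, $1\leqslant j\leqslant m$, such that $f(x)\geqslant\prod_{j=1}^m f_j^{p_j}(x_j)$ whenever $x=\sum_{j=1}^m p_jx_j$ for some $x_j\in H_j$, we have $$\int_{\mathbb{R}^n}f(x)\,dx\geqslant\frac{1}{BL_2}\prod_{j=1}^m\left(\int_{H_j}f_j(x)\,dx\right)^{p_j}.$$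
   Context: $[n]=\{1,\dots,n\}$. For $m\geqslant1$, subsets $S_1,\dots,S_m\subseteq[n]$ (not necessarily distinct) form a uniform cover of $[n]$ with weights $(p_1,\dots,p_m)$, $p_j>0$ for all $j$, if $\sum_{j=1}^m p_j\chi_{S_j}(i)=1$ for every $i\in[n]$. For vectors $u_1,\dots,u_k$, $|\wedge_{i=1}^k u_i|$ is the $k$-dimensional volume of the parallelepiped they span (equal to $1$ for the empty family). $P_F$ is the orthogonal projection onto the linear subspace $F$ of $\mathbb{R}^n$. Integrals over a subspace are with respect to its Lebesgue measure (unit point mass on $\{0\}$). *)

(* Defs.v *)
From HB Require Import structures.
From mathcomp Require Import all_boot all_order all_algebra.
From mathcomp Require Import all_classical all_reals all_analysis.
From mathcomp Require Import measurable_realfun.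

Set Implicit Arguments.
Unset Strict Implicit.
Unset Printing Implicit Defensive.

Import Order.TTheory GRing.Theory Num.Theory.
Import numFieldNormedType.Exports.

Local Open Scope classical_set_scope.
Local Open Scope ring_scope.

Section measurable_rV.
Context {R : realType}.
Variable n : nat.

Let coords : 'I_n -> 'rV[R]_n -> measurableTypeR R := fun i v => v ord0 i.

Let rV_set0 : g_sigma_preimage coords set0.
Proof. exact: sigma_algebra0. Qed.

Let rV_setC A : g_sigma_preimage coords A -> g_sigma_preimage coords (~` A).
Proof. exact: sigma_algebraC. Qed.

Let rV_bigcup (F : (set 'rV[R]_n)^nat) :
  (forall i, g_sigma_preimage coords (F i)) ->
  g_sigma_preimage coords (\bigcup_i (F i)).
Proof. exact: sigma_algebra_bigcup. Qed.

(* The Borel sigma-algebra of R^n, generated by the coordinates. *)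
HB.instance Definition _ := @isMeasurable.Build default_measure_display
  'rV[R]_n (g_sigma_preimage coords) rV_set0 rV_setC rV_bigcup.

Lemma measurable_coord (i : 'I_n) :
  measurable_fun [set: 'rV[R]_n] (fun v => v ord0 i : measurableTypeR R).
Proof.
move=> _ Y mY; rewrite setTI; apply: sub_sigma_algebra => /=.
rewrite -bigcup_seq/=; exists i => /=; first by rewrite mem_index_enum.
by exists Y => //; rewrite setTI.
Qed.

Lemma measurable_fun_rV d (T : measurableType d) (f : T -> 'rV[R]_n) :
  (forall i, measurable_fun [set: T] (fun x => f x ord0 i : measurableTypeR R)) ->
  measurable_fun [set: T] f.
Proof.
move=> mf; apply: (@measurability _ _ _ _ _ _
  (\big[setU/set0]_(i < n) preimage_set_system setT (coords i) measurable)) => //.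
move=> _ [B + <-].
rewrite -bigcup_seq/= => -[i _ [C mC <-]].
by have := mf i measurableT C mC; rewrite !setTI.
Qed.

End measurable_rV.

Section lebesgue_rV.
Context {R : realType}.

Definition rV_cons d (p : measurableTypeR R * 'rV[R]_d) : 'rV[R]_d.+1 :=
  row_mx (const_mx p.1 : 'rV_1) p.2.

Lemma rV_consE d p (i : 'I_d.+1) : @rV_cons d p ord0 i =
  if unlift ord0 i is Some j then p.2 ord0 j else p.1.
Proof.
rewrite /rV_cons; case: unliftP => [j ->|->].
  rewrite (_ : lift _ _ = rshift 1 j); last exact/val_inj.
  exact: (@row_mxEr _ 1 1 d).
rewrite (_ : (ord0 : 'I_d.+1) = lshift d (ord0 : 'I_1)); last exact/val_inj.
by rewrite (@row_mxEl _ 1 1 d) mxE.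
Qed.

Lemma measurable_rV_cons d : measurable_fun [set: _] (@rV_cons d).
Proof.
apply: measurable_fun_rV => i.
under [X in measurable_fun _ X]eq_fun do rewrite rV_consE.
case: unlift => [j|]; last exact: measurable_fst.
exact: (measurableT_comp (measurable_coord j) measurable_snd).
Qed.

Section cons_measure.
Variables (d : nat) (m : {sigma_finite_measure set 'rV[R]_d -> \bar R}).

Definition cons_measure : set 'rV[R]_d.+1 -> \bar R :=
  pushforward (lebesgue_measure \x m)%E (@rV_cons d).

Let cons0 : cons_measure set0 = 0%E.
Proof. by rewrite /cons_measure /pushforward preimage_set0 measure0. Qed.

Let cons_ge0 A : (0 <= cons_measure A)%E.
Proof. exact: (measure_ge0 (lebesgue_measure \x m)%E). Qed.

Let cons_additive : semi_sigma_additive cons_measure.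
Proof.
exact: (@measure_semi_sigma_additive _ _ _
  (measure_function_pushforward__canonical__measure_function_Measure
    (lebesgue_measure \x m)%E (@measurable_rV_cons d))).
Qed.

HB.instance Definition _ := isMeasure.Build _ _ _ cons_measure
  cons0 cons_ge0 cons_additive.

Let split_rV (v : 'rV[R]_d.+1) : measurableTypeR R * 'rV[R]_d :=
  (v ord0 ord0, \row_j v ord0 (lift ord0 j)).

Let measurable_split : measurable_fun [set: _] split_rV.
Proof.
apply/measurable_fun_pairP; split; first exact: measurable_coord.
apply: measurable_fun_rV => i /=.
under [X in measurable_fun _ X]eq_fun do rewrite mxE.
exact: measurable_coord.
Qed.

Let rV_consK : cancel (@rV_cons d) split_rV.
Proof.
move=> [x v]; rewrite /split_rV rV_consE unlift_none; congr pair.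
by apply/rowP => j; rewrite mxE rV_consE liftK.
Qed.

Let cons_sigma_finite : sigma_finite setT cons_measure.
Proof.
have /sigma_finiteP[F [FT ndF Foo]] := sigma_finiteT (@lebesgue_measure R).
have /sigma_finiteP[G [GT ndG Goo]] := sigma_finiteT m.
exists (fun k => split_rV @^-1` (F k `*` G k)).
  rewrite -preimage_bigcup (_ : \bigcup_k _ = setT) ?preimage_setT//.
  rewrite -setXTT FT GT predeqE => -[x y]; split.
    by move=> [n _ []/= ? ?]; split; exists n.
  move=> [/= [n _ Fnx] [k _ Gky]]; exists (maxn n k) => //; split.
  - by move: x Fnx; exact/subsetPset/ndF/leq_maxl.
  - by move: y Gky; exact/subsetPset/ndG/leq_maxr.
move=> k; have [mF Fk] := Foo k; have [mG Gk] := Goo k; split.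
  rewrite -[X in measurable X]setTI; apply: measurable_split => //.
  exact: measurableX.
rewrite /cons_measure /pushforward -comp_preimage.
rewrite (_ : _ \o _ = id) ?funeqE//.
by rewrite preimage_id product_measure1E// lte_mul_pinfty// ge0_fin_numE.
Qed.

HB.instance Definition _ := Measure_isSigmaFinite.Build _ _ _ cons_measure
  cons_sigma_finite.

End cons_measure.

(* Lebesgue measure on the Borel sets of R^d. *)
Fixpoint borel_lebesgue d : {sigma_finite_measure set 'rV[R]_d -> \bar R} :=
  if d is d'.+1
  then cons_measure (borel_lebesgue d') : {sigma_finite_measure set _ -> \bar R}
  else dirac (0 : 'rV[R]_0) : {sigma_finite_measure set _ -> \bar R}.

Lemma borel_lebesgue_box d (A : 'I_d -> set (measurableTypeR R)) :
  (forall i, measurable (A i)) ->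
  borel_lebesgue d [set v : 'rV[R]_d | forall i, A i (v ord0 i)] =
  (\prod_(i < d) lebesgue_measure (A i))%E.
Proof.
elim: d A => [|d IH] A mA.
  rewrite big_ord0 /= diracE mem_set//; by move=> [].
rewrite big_ord_recl /= /cons_measure /pushforward.
rewrite (_ : _ @^-1` _ = A ord0 `*` [set v : 'rV[R]_d | forall i, A (lift ord0 i) (v ord0 i)]).
  rewrite product_measure1E//; first by rewrite (IH (fun i => A (lift ord0 i))).
  rewrite (_ : [set _ | _] =
    \big[setI/setT]_(i < d) ((fun v : 'rV[R]_d => v ord0 i) @^-1` A (lift ord0 i))).
    apply: bigsetI_measurable => i _; rewrite -[X in measurable X]setTI; exact: measurable_coord.
  rewrite -bigcap_seq; apply/seteqP; split => v /= h; first by move=> i _; exact: h.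
  by move=> i; apply: (h i); rewrite /= mem_index_enum.
apply/seteqP; split => -[x v] /=.
  move=> h; split; first by have := h ord0; rewrite rV_consE unlift_none.
  by move=> i; have := h (lift ord0 i); rewrite rV_consE liftK.
move=> [h1 h2] i; rewrite rV_consE; case: unliftP => [j ->|->]//; exact: h2.
Qed.

End lebesgue_rV.

(* Lebesgue measure on the Lebesgue-measurable subsets of R^d. *)
Definition lebesgue_rV {R : realType} d :=
  @completed_measure_extension _ _ _ (@borel_lebesgue R d).
Arguments lebesgue_rV {R} d.
HB.instance Definition _ (R : realType) d := Measure.on (@lebesgue_rV R d).

Section euclidean.
Context {R : realType} {n : nat}.
Local Notation V := 'rV[R]_n.
Implicit Types (u v x y : V) (F : {vspace V}).

Definition dotv u v : R := \sum_(i < n) u ord0 i * v ord0 i.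

Lemma dotvC u v : dotv u v = dotv v u.
Proof. by apply: eq_bigr => i _; rewrite mulrC. Qed.

Lemma dotvDl u v x : dotv (u + v) x = dotv u x + dotv v x.
Proof. by rewrite -big_split; apply: eq_bigr => i _; rewrite mxE mulrDl. Qed.

Lemma dotvZl a u x : dotv (a *: u) x = a * dotv u x.
Proof. by rewrite mulr_sumr; apply: eq_bigr => i _; rewrite mxE mulrA. Qed.

Lemma dotv0l x : dotv 0 x = 0.
Proof. by apply: big1 => i _; rewrite mxE mul0r. Qed.

Lemma dotvBl u v x : dotv (u - v) x = dotv u x - dotv v x.
Proof. by rewrite dotvDl -[- v]scaleN1r dotvZl mulN1r. Qed.

Lemma dotv_suml I (r : seq I) (P : pred I) (F : I -> V) x :
  dotv (\sum_(i <- r | P i) F i) x = \sum_(i <- r | P i) dotv (F i) x.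
Proof.
apply: (big_morph (dotv^~ x)) => [u v|]; [exact: dotvDl|exact: dotv0l].
Qed.

Lemma dotvv_gt0 u : u != 0 -> 0 < dotv u u.
Proof.
move=> u0; rewrite lt0r sumr_ge0 ?andbT => [|i _]; last first.
  by rewrite -expr2 sqr_ge0.
apply: contra u0; rewrite psumr_eq0 => [/allP /= h|i _]; last first.
  by rewrite -expr2 sqr_ge0.
apply/eqP/rowP => i; rewrite mxE; apply/eqP.
by have := h i (mem_index_enum _); rewrite mulf_eq0 orbb.
Qed.

Definition orthonormal_basis F (b : (\dim F).-tuple V) :=
  basis_of F b /\
  forall i j, dotv (tnth b i) (tnth b j) = (i == j)%:R.

Let orthonormal (b : seq V) := forall i j, (i < size b)%N -> (j < size b)%N ->
  dotv b`_i b`_j = (i == j)%:R.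

Let orthonormal_free b : orthonormal b -> free b.
Proof.
move=> ob; apply/(@freeP _ _ _ (in_tuple b)) => k k0 i.
have := congr1 (dotv^~ b`_i) k0; rewrite dotv0l dotv_suml.
rewrite (bigD1 i)//= big1 ?addr0 => [|j ji].
  by rewrite dotvZl ob// eqxx mulr1.
rewrite dotvZl ob// (negbTE (_ : (j != i :> nat))) ?mulr0//.
Qed.

Let orthonormal_sub F k : (k <= \dim F)%N -> exists b : seq V,
  [/\ size b = k, {subset b <= F} & orthonormal b].
Proof.
elim: k => [_|k IH kF]; first by exists [::]; split.
have [b [sb bF ob]] := IH (ltnW kF).
have /subvPn[v vF vb] : ~~ (F <= <<b>>)%VS.
  apply/negP => /dimvS Fb; have := leq_ltn_trans (leq_trans Fb (dim_span b)).
  by move=> /(_ (\dim F)); rewrite sb => /(_ kF); rewrite ltnn.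
pose v' := v - \sum_(i < size b) dotv v b`_i *: b`_i.
have sumF (G : {vspace V}) (c : nat -> R) : {subset b <= G} ->
    \sum_(i < size b) c i *: b`_i \in G.
  by move=> bG; apply: memv_suml => i _; apply/memvZ/bG/mem_nth.
have v'F : v' \in F by rewrite rpredB// (sumF F (fun i => dotv v b`_i)).
have v'0 : v' != 0.
  apply: contra vb; rewrite subr_eq0 => /eqP ->.
  by apply: (sumF _ (fun i => dotv v b`_i)) => x xb; exact: memv_span.
have v'b j : (j < size b)%N -> dotv v' b`_j = 0.
  move=> jb; rewrite dotvBl dotv_suml (bigD1 (Ordinal jb))//= big1 ?addr0.
    by rewrite dotvZl ob// eqxx mulr1 subrr.
  move=> i ij; rewrite dotvZl ob//.
  by rewrite (negbTE (_ : (i != j :> nat))) ?mulr0.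
have c0 := dotvv_gt0 v'0.
exists (rcons b ((Num.sqrt (dotv v' v'))^-1 *: v')); split.
- by rewrite size_rcons sb.
- by move=> x; rewrite mem_rcons inE => /predU1P[->|/bF//]; rewrite memvZ.
- move=> i j; rewrite size_rcons !ltnS !nth_rcons.
  rewrite [(i <= _)%N]leq_eqVlt [(j <= _)%N]leq_eqVlt => /predU1P[->|ib] /predU1P[->|jb].
  + rewrite ltnn eqxx dotvZl dotvC dotvZl mulrA -invfM -expr2.
    by rewrite sqr_sqrtr ?(ltW c0)// mulVf// gt_eqF.
  + by rewrite ltnn eqxx jb dotvZl v'b// mulr0 gtn_eqF.
  + by rewrite ltnn eqxx ib dotvC dotvZl v'b// mulr0 ltn_eqF.
  + by rewrite ib jb ob.
Qed.

Lemma orthonormal_basis_exists F : exists b, @orthonormal_basis F b.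
Proof.
have [b [sb bF ob]] := orthonormal_sub (leqnn (\dim F)).
have sb' : size b == \dim F by exact/eqP.
exists (Tuple sb'); split; last first.
  by move=> i j; rewrite !(tnth_nth 0)/= ob ?sb.
rewrite basisEfree orthonormal_free//= sb leqnn andbT.
by apply/span_subvP.
Qed.

Definition onb F : (\dim F).-tuple V :=
  xget [tuple of nseq _ 0] (@orthonormal_basis F).

Lemma onbP F : orthonormal_basis (onb F).
Proof. exact: xgetPex (orthonormal_basis_exists F). Qed.

Definition orthoproj F x : V :=
  xget 0 [set y | y \in F /\ forall z, z \in F -> dotv (x - y) z = 0].

Lemma orthoprojP F x :
  orthoproj F x \in F /\ forall z, z \in F -> dotv (x - orthoproj F x) z = 0.
Proof.
suff : exists y, y \in F /\ forall z, z \in F -> dotv (x - y) z = 0.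
  exact: xgetPex.
have [bF ob] := onbP F; pose b := onb F.
exists (\sum_i dotv x (tnth b i) *: tnth b i); split.
  by apply: memv_suml => i _; rewrite memvZ// (basis_mem bF)// mem_tnth.
move=> z zF; rewrite (coord_basis bF zF) dotvC dotv_suml big1// => i _.
rewrite dotvZl dotvC -(tnth_nth 0) dotvBl dotv_suml (bigD1 i)//= big1.
  by rewrite addr0 dotvZl ob eqxx mulr1 subrr mulr0.
by move=> j ji; rewrite dotvZl ob (negbTE ji) mulr0.
Qed.

(* The linear isometry from R^(dim F) onto F attached to [onb F]. *)
Definition onb_map F (t : 'rV[R]_(\dim F)) : V :=
  \sum_i t ord0 i *: tnth (onb F) i.

Lemma measurable_onb_map F : measurable_fun [set: _] (@onb_map F).
Proof.
apply: measurable_fun_rV => i.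
under [X in measurable_fun _ X]eq_fun.
  move=> t; rewrite /onb_map summxE.
  under eq_bigr do rewrite mxE.
  over.
apply: measurable_sum => j; apply: measurable_funM => //.
exact: measurable_coord.
Qed.

Section subspace_measure.
Variable F : {vspace V}.

Definition borel_lebesgue_sub : set V -> \bar R :=
  pushforward (borel_lebesgue (\dim F)) (@onb_map F).

Let sub0 : borel_lebesgue_sub set0 = 0%E.
Proof. by rewrite /borel_lebesgue_sub /pushforward preimage_set0 measure0. Qed.

Let sub_ge0 A : (0 <= borel_lebesgue_sub A)%E.
Proof. exact: (measure_ge0 (borel_lebesgue (\dim F))). Qed.

Let sub_additive : semi_sigma_additive borel_lebesgue_sub.
Proof.
exact: (@measure_semi_sigma_additive _ _ _
  (measure_function_pushforward__canonical__measure_function_Measure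
    (borel_lebesgue (\dim F)) (@measurable_onb_map F))).
Qed.

HB.instance Definition _ := isMeasure.Build _ _ _ borel_lebesgue_sub
  sub0 sub_ge0 sub_additive.

(* Lebesgue measure of the subspace F, as a measure on R^n carried by F:
   A is measurable iff A `&` F is Lebesgue measurable in F. *)
Definition lebesgue_sub := @completed_measure_extension _ _ _ borel_lebesgue_sub.
HB.instance Definition _ := Measure.on lebesgue_sub.

End subspace_measure.
Arguments borel_lebesgue_sub F : clear implicits.
Arguments lebesgue_sub F : clear implicits.

Definition parallelepiped (us : seq V) : set V :=
  [set \sum_(i < size us) t i *: us`_i
     | t in [set t : 'I_(size us) -> R | forall i, 0 <= t i <= 1]].

(* |u_1 /\ ... /\ u_k|: a dependent family spans a degenerate parallelepiped,
   whose k-dimensional volume is 0, while [lebesgue_sub <<us>>] is the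
   measure of dimension k when us is free. *)
Definition wedge_norm (us : seq V) : R :=
  if free us then fine (lebesgue_sub <<us>>%VS (parallelepiped us)) else 0.

End euclidean.
Arguments borel_lebesgue_sub {R n} F.
Arguments lebesgue_sub {R n} F.

Definition uniform_cover (R : realType) n m (S : 'I_m -> {set 'I_n})
    (p : 'I_m -> R) :=
  (forall j, 0 < p j) /\
  (forall i : 'I_n, \sum_(j < m) p j * (i \in S j)%:R = 1).

Definition BL2 (R : realType) n m (w : 'I_n -> 'rV[R]_n)
    (S : 'I_m -> {set 'I_n}) (p : 'I_m -> R) : R :=
  (\prod_(j < m) wedge_norm [seq w k | k in S j] `^ p j)
    / wedge_norm [seq w i | i : 'I_n].

(* Main.v *)
Require Import Defs.
From mathcomp Require Import all_boot all_order all_algebra.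
From mathcomp Require Import all_classical all_reals all_analysis.
From mathcomp Require Import measurable_realfun ring lra.

Set Implicit Arguments.
Unset Strict Implicit.
Unset Printing Implicit Defensive.

Import Order.TTheory GRing.Theory Num.Theory.
Import numFieldNormedType.Exports.

Local Open Scope classical_set_scope.
Local Open Scope ring_scope.

(** Expressed in suitable coordinates, both inequalities become statements about
    coordinate subspaces.

    Let W be the matrix with rows w_i. For the first inequality put y = x W^T, so
    that the entries of y are the scalar products of x with the w_i. The
    projection of x on H_j depends only on the entries of y in S_j: they are its
    coordinates in the basis of H_j that is dual to (w_k), k in S_j. For the
    second inequality write x = y W and x_j = t_j W with t_j supported by S_j. In
    both cases the Jacobians are powers of the volumes of the parallelepipeds
    spanned by the w_k, which combine to the constant BL2: volumes are square
    roots of Gram determinants, and those of dual bases are inverse to each other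
    ([ge0_integral_mulmx], [ge0_integral_sub_mx], [wedge_normE]). What remains is,
    for functions h_j of the coordinates in S_j only,

    - [finner]: the integral of the product of the h_j^{p_j} is at most the
      product of the p_j-th powers of the integrals of the h_j;
    - [reverse_finner]: if F (sum of the p_j t_j) is at least the product of the
      h_j (t_j)^{p_j} for all t_j supported by S_j, then the integral of F is at
      least the product of the p_j-th powers of the integrals of the h_j.

    Both are proved by induction on n, one coordinate at a time. The weights of
    the sets that contain a given coordinate sum to 1, so the one-dimensional
    step is the Hoelder inequality for several functions ([hoelder_prod]) in the
    first case and the Prekopa-Leindler inequality for several functions
    ([prekopa_leindler]) in the second. The latter follows from the
    Brunn-Minkowski inequality on the line ([brunn_minkowski1]) applied to the
    superlevel sets of the functions, and from the inequality between weighted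
    geometric and arithmetic means.

    The functions of the theorem are only measurable for completed Lebesgue
    measures. They are first replaced by Borel majorants or minorants with the
    same integrals ([completion_envelopes]), as Tonelli's theorem and the changes
    of variables are applied to Borel functions. *)

(** * Linear changes of variables *)

Section affine1.
Context {R : realType}.
Local Notation mu := (@lebesgue_measure R).
Implicit Types (f : measurableTypeR R -> \bar R) (a b : R).

Lemma measurable_affine a b :
  measurable_fun [set: measurableTypeR R]
    (fun x : measurableTypeR R => x * a + b : measurableTypeR R).
Proof. by apply: measurable_funD => //; apply: measurable_funM. Qed.

(** Both sides are measures in A, so half-open intervals suffice. The two cases
    come from the sign of a, which decides which end of the preimage is open. *)
Lemma lebesgue_measure_affine a b (A : set (measurableTypeR R)) : a != 0 ->
  measurable A -> mu A = (`|a|%:E * mu ((fun x : R => (x * a + b)%R) @^-1` A))%E.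
Proof.
move=> a0 mA.
have a_ge0 : 0 <= `|a| by [].
pose k := NngNum a_ge0.
pose m0 : {measure set (measurableTypeR R) -> \bar R} :=
  measure_function_pushforward__canonical__measure_function_Measure
    mu (@measurable_affine a b).
pose m : {measure set (measurableTypeR R) -> \bar R} := mscale k m0.
have := @lebesgue_measure_unique _ m.
move=> /(_ _ _ mA) -> // _ [[u v]] _ <-.
rewrite /m /= /mscale /= /pushforward.
rewrite lebesgue_measure_itv.
have [ap|an] := ltP 0 a.
  have -> : (fun x : R => x * a + b) @^-1` `]u, v] = `](u - b) / a, (v - b) / a]%classic.
    apply/seteqP; split => x /=; rewrite !in_itv/= ltr_pdivrMr// ler_pdivlMr//;
      by rewrite ltrBlDr lerBrDr.
  rewrite lebesgue_measure_itv /= !lte_fin ltr_pM2r ?invr_gt0// ltrD2r.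
  case: ifPn => uv; last by rewrite mule0.
  rewrite gtr0_norm// -!EFinB -EFinM; congr EFin; field.
  exact: lt0r_neq0.
have {}an : a < 0 by rewrite lt_neqAle a0.
have -> : (fun x : R => x * a + b) @^-1` `]u, v] = `[(v - b) / a, (u - b) / a[%classic.
  apply/seteqP; split => x /=; rewrite !in_itv/= ltr_ndivlMr// ler_ndivrMr//;
    by rewrite ltrBlDr lerBrDr andbC.
rewrite lebesgue_measure_itv /= !lte_fin ltr_nM2r ?invr_lt0// ltrD2r.
case: ifPn => uv; last by rewrite mule0.
rewrite ltr0_norm// -!EFinB -EFinM; congr EFin; field.
exact: ltr0_neq0.
Qed.

Lemma ge0_integral_affine f a b : a != 0 ->
  measurable_fun setT f -> (forall x, 0 <= f x)%E ->
  (\int[mu]_x f x = `|a|%:E * \int[mu]_x f (x * a + b)%R)%E.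
Proof.
move=> a0 mf f0.
have a_ge0 : 0 <= `|a| by [].
pose k := NngNum a_ge0.
pose m0 : {measure set (measurableTypeR R) -> \bar R} :=
  measure_function_pushforward__canonical__measure_function_Measure
    mu (@measurable_affine a b).
rewrite (_ : \int[mu]_x f (x * a + b)%R = \int[m0]_x f x)%E; last first.
  by rewrite ge0_integral_pushforward//; exact: measurable_affine.
rewrite -(ge0_integral_mscale m0 measurableT k)//.
apply: eq_measure_integral => A mA _.
exact: (lebesgue_measure_affine b a0 mA).
Qed.

End affine1.

Section borel_lebesgue_integral.
Context {R : realType}.
Local Notation mu := (@lebesgue_measure R).
Local Notation leb := (@borel_lebesgue R).
Local Open Scope ereal_scope.

Lemma measurable_mulmx d n (A : 'M[R]_(d, n)) :
  measurable_fun [set: 'rV[R]_d] (fun t => t *m A).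
Proof.
apply: measurable_fun_rV => i.
under eq_fun do rewrite mxE.
apply: measurable_sum => j; apply: measurable_funM => //.
exact: measurable_coord.
Qed.

Lemma measurable_rV_add n : measurable_fun [set: 'rV[R]_n * 'rV[R]_n]
  (fun p => (p.1 + p.2)%R).
Proof.
apply: measurable_fun_rV => i.
under eq_fun do rewrite mxE.
apply: measurable_funD; apply: (measurableT_comp (measurable_coord i)).
  exact: measurable_fst.
exact: measurable_snd.
Qed.

Lemma measurable_funD_rV d (T : measurableType d) n (f g : T -> 'rV[R]_n) :
  measurable_fun setT f -> measurable_fun setT g ->
  measurable_fun setT (fun x => (f x + g x)%R).
Proof.
move=> mf mg.
exact: (measurableT_comp (@measurable_rV_add n) (measurable_fun_pair mf mg)).
Qed.

Lemma measurable_fun_cons d (T : measurableType d) n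
    (f : T -> measurableTypeR R) (g : T -> 'rV[R]_n) :
  measurable_fun setT f -> measurable_fun setT g ->
  measurable_fun setT (fun x => rV_cons (f x, g x)).
Proof.
move=> mf mg.
exact: (measurableT_comp (@measurable_rV_cons R n) (measurable_fun_pair mf mg)).
Qed.

(** Tonelli: the measure in dimension d + 1 is the image of a product measure.
    The inductions on the dimension rest on this formula. *)
Lemma ge0_integral_leb_cons d (f : 'rV[R]_d.+1 -> \bar R) :
  measurable_fun setT f -> (forall v, 0 <= f v) ->
  \int[leb d.+1]_v f v = \int[mu]_x \int[leb d]_v f (rV_cons (x, v)).
Proof.
move=> mf f0.
rewrite -(@fubini_tonelli1 _ _ _ _ _ mu (leb d) (f \o @rV_cons R d))//=; last first.
  exact: (measurableT_comp mf (@measurable_rV_cons R d)).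
by rewrite ge0_integral_pushforward//; exact: measurable_rV_cons.
Qed.

Lemma measurable_fun_leb_integral d' (T : measurableType d') d
    (f : T -> 'rV[R]_d -> \bar R) :
  measurable_fun setT (fun p : T * 'rV[R]_d => f p.1 p.2) ->
  (forall x v, 0 <= f x v) ->
  measurable_fun setT (fun x => \int[leb d]_v f x v).
Proof.
move=> mf f0.
exact: (@measurable_fun_fubini_tonelli_F _ _ _ _ _ (leb d) _ mf
  (fun p => f0 p.1 p.2)).
Qed.

Lemma ge0_integral_leb_shift d (c : 'rV[R]_d) (f : 'rV[R]_d -> \bar R) :
  measurable_fun setT f -> (forall v, 0 <= f v) ->
  \int[leb d]_v f (v + c)%R = \int[leb d]_v f v.
Proof.
elim: d c f => [|d IH] c f mf f0.
  by apply: eq_integral => v _; congr f; apply/rowP => -[].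
rewrite [RHS]ge0_integral_leb_cons// ge0_integral_leb_cons//; last first.
  apply: (measurableT_comp mf); exact: measurable_funD_rV.
rewrite [RHS](@ge0_integral_affine _ _ 1 (c ord0 ord0))//; last 2 first.
- apply: measurable_fun_leb_integral => //=.
  by apply: (measurableT_comp mf); apply: measurable_fun_cons.
- by move=> x; exact: integral_ge0.
rewrite normr1 mul1e; apply: eq_integral => x _.
pose c' : 'rV[R]_d := \row_i c ord0 (lift ord0 i).
rewrite -(IH c' (fun v => f (rV_cons ((x * 1 + c ord0 ord0)%R, v)))); last 2 first.
- by apply: (measurableT_comp mf); apply: measurable_fun_cons.
- by move=> v.
apply: eq_integral => v _; congr f.
apply/rowP => i; rewrite mxE !rV_consE.
case: unliftP => [j ->|->]; first by rewrite /= !mxE.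
by rewrite mulr1.
Qed.

Lemma rV_cons_block d x (v : 'rV[R]_d) a (r : 'rV_d) (c : 'cV_d) (B : 'M[R]_d) :
  (rV_cons (x, v) *m (block_mx a%:M r c B : 'M[R]_(1 + d)))%R =
  rV_cons ((x * a + (v *m c) ord0 ord0)%R, (x *: r + v *m B)%R).
Proof.
rewrite /rV_cons (@mul_row_block _ 1 1 d 1 d); congr row_mx; last first.
  rewrite /= (_ : const_mx x = x%:M) ?mul_scalar_mx//.
  by apply/matrixP => i j; rewrite !mxE !ord1.
apply/matrixP => i j; rewrite !ord1 /= mul_mx_scalar !mxE.
by rewrite mulrC.
Qed.

(** A property of the matrix A, to be propagated along a factorization of A. *)
Definition integral_scaled_by_det d (A : 'M[R]_d) :=
  forall f : 'rV[R]_d -> \bar R, measurable_fun setT f -> (forall v, 0 <= f v) ->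
  \int[leb d]_v f v = `|\det A|%:E * \int[leb d]_v f (v *m A).

Lemma integral_scaled_by_detM d (A B : 'M[R]_d) :
  integral_scaled_by_det A -> integral_scaled_by_det B ->
  integral_scaled_by_det (A *m B).
Proof.
move=> hA hB f mf f0; rewrite hB// hA//; last first.
  exact: (measurableT_comp mf (measurable_mulmx B)).
rewrite det_mulmx normrM EFinM muleA [(`|_|%:E * _)]muleC; congr (_ * _).
by apply: eq_integral => v _; rewrite mulmxA.
Qed.

(** The image of (x, v) is (x a, x r + v B). Integrated over v first, x r is a
    translation and disappears; then only the scaling by a is left. *)
Lemma integral_scaled_by_det_ublock d a (r : 'rV_d) (B : 'M[R]_d) : a != 0%R ->
  integral_scaled_by_det B ->
  integral_scaled_by_det (block_mx a%:M r 0 B : 'M[R]_(1 + d)).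
Proof.
move=> a0 hB f mf f0.
rewrite ge0_integral_leb_cons// ge0_integral_leb_cons//; last first.
  exact: (measurableT_comp mf (measurable_mulmx _)).
rewrite (@det_ublock _ 1) det_scalar1 normrM EFinM -muleA.
have mF : measurable_fun [set: measurableTypeR R]
    (fun x => \int[leb d]_v f (rV_cons (x, v))).
  apply: measurable_fun_leb_integral => //=.
  by apply: (measurableT_comp mf); apply: measurable_fun_cons.
rewrite (@ge0_integral_affine _ _ a 0)//; last first.
  by move=> x; exact: integral_ge0.
congr (_ * _); rewrite -ge0_integralZl//; last 2 first.
- apply: measurable_fun_leb_integral => //=.
  apply: (measurableT_comp mf); apply: (measurableT_comp (measurable_mulmx _)).
  by apply: measurable_fun_cons.
- by move=> x _; exact: integral_ge0.
apply: eq_integral => x _.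
rewrite -(@ge0_integral_leb_shift _ (x *: r)
  (fun v => f (rV_cons ((x * a + 0)%R, v)))); last 2 first.
- by apply: (measurableT_comp mf); apply: measurable_fun_cons.
- by move=> v.
rewrite hB//; last first.
  apply: (measurableT_comp mf); apply: measurable_fun_cons => //.
  exact: measurable_funD_rV.
congr (_ * _); apply: eq_integral => v _.
by rewrite rV_cons_block mulmx0 mxE [(v *m _ + _)%R]addrC.
Qed.

(** The image of (x, v) is (x + v c, v), a translation in x for fixed v: here x
    has to be integrated first. *)
Lemma integral_scaled_by_det_transvection d (c : 'cV_d) :
  integral_scaled_by_det (block_mx 1%:M 0 c 1%:M : 'M[R]_(1 + d)).
Proof.
move=> f mf f0.
rewrite ge0_integral_leb_cons// ge0_integral_leb_cons//; last first.
  exact: (measurableT_comp mf (measurable_mulmx _)).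
rewrite (@det_lblock _ 1) !det1 mulr1 normr1 mul1e.
rewrite (@fubini_tonelli _ _ _ _ _ mu (leb d) (fun p => f (rV_cons p)))//; last first.
  exact: (measurableT_comp mf (@measurable_rV_cons R d)).
rewrite (@fubini_tonelli _ _ _ _ _ mu (leb d)
  (fun p => f (rV_cons p *m (block_mx 1%:M 0 c 1%:M : 'M[R]_(1 + d)))))//; last first.
  apply: (measurableT_comp mf); apply: (measurableT_comp (measurable_mulmx _)).
  exact: (@measurable_rV_cons R d).
apply: eq_integral => v _.
rewrite (@ge0_integral_affine _ _ 1 ((v *m c) ord0 ord0))//; last first.
  by apply: (measurableT_comp mf); apply: measurable_fun_cons.
rewrite normr1 mul1e; apply: eq_integral => x _.
by rewrite rV_cons_block scaler0 add0r mulmx1.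
Qed.

(** Gaussian elimination. A matrix with a nonzero corner is a transvection times
    a block triangular matrix whose lower block, the Schur complement of the
    corner, falls under the induction hypothesis. A zero corner is made nonzero
    by adding another row to the first one, and this operation is itself the
    product with a block triangular matrix. *)
Theorem ge0_integral_mulmx d (A : 'M[R]_d) : \det A != 0%R ->
  integral_scaled_by_det A.
Proof.
elim: d A => [|d IH] A detA.
  move=> f mf f0; rewrite det_mx00 normr1 mul1e; apply: eq_integral => v _.
  by congr f; apply/rowP => -[].
have pivot (B : 'M[R]_(1 + d)) : (B ord0 ord0 != 0 -> \det B != 0 ->
    integral_scaled_by_det B)%R.
  move=> B0 detB.
  pose a := B ord0 ord0.
  have BE : B = (block_mx 1%:M 0 (a^-1 *: dlsubmx B) 1%:M) *m
      (block_mx a%:M (ursubmx B) 0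
        (drsubmx B - a^-1 *: (dlsubmx B *m ursubmx B)))%R.
    rewrite -[LHS]submxK mulmx_block !mul1mx !mul0mx !addr0.
    rewrite mul_mx_scalar scalerA divff// scale1r -scalemxAl addrC subrK.
    congr block_mx; apply/matrixP => i j; rewrite !mxE !ord1 mulr1n.
    by congr (B _ _); apply/val_inj.
  rewrite BE; apply: integral_scaled_by_detM.
    exact: integral_scaled_by_det_transvection.
  apply: integral_scaled_by_det_ublock => //; apply: IH.
  move: detB; rewrite {1}BE det_mulmx (@det_lblock _ 1) (@det_ublock _ 1).
  by rewrite !det1 !mul1r mulf_eq0 negb_or => /andP[].
have [B0|] := eqVneq (A ord0 ord0) 0%R; last by move=> B0; exact: pivot.
have [i Ai0] : exists i : 'I_d, A (lift ord0 i) ord0 != 0%R.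
  apply/existsP; apply: contraNT detA; rewrite negb_exists => /forallP A0.
  rewrite (expand_det_col _ ord0) big1// => i _.
  case: (unliftP ord0 i) => [j ->|->]; last by rewrite B0 mul0r.
  by have := A0 j; rewrite negbK => /eqP ->; rewrite mul0r.
(* E 1 adds the row of index lift ord0 i to the first row; E (- 1) undoes it. *)
pose E (s : R) : 'M[R]_(1 + d) :=
  (block_mx 1%:M (s *: delta_mx ord0 i) 0 1%:M)%R.
have EE : (E (-1) *m E 1 = 1%:M)%R.
  rewrite /E mulmx_block !mul1mx !mul0mx !mulmx0 !addr0 !mulmx1 add0r.
  by rewrite scale1r scaleN1r subrr -scalar_mx_block.
have detE s : (\det (E s) = 1)%R by rewrite /E (@det_ublock _ 1) !det1 mulr1.
have -> : A = (E (-1)%R *m (E 1%R *m A)) by rewrite mulmxA EE mul1mx.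
apply: integral_scaled_by_detM.
  apply: integral_scaled_by_det_ublock; first exact: oner_neq0.
  by apply: IH; rewrite det1 oner_neq0.
apply: pivot; last by rewrite det_mulmx detE mul1r.
have E0 j : (E 1 ord0 (lift ord0 j) = (j == i)%:R)%R.
  rewrite /E (_ : lift ord0 j = rshift 1 j); last exact/val_inj.
  rewrite (_ : (ord0 : 'I_(1 + d)) = lshift d ord0); last exact/val_inj.
  by rewrite (@block_mxEur _ 1 d 1 d) scale1r mxE eqxx.
rewrite mxE big_ord_recl B0 mulr0 add0r (bigD1 i)//= big1 => [|j ji].
  by rewrite addr0 E0 eqxx mul1r.
by rewrite E0 (negbTE ji) mul0r.
Qed.

End borel_lebesgue_integral.

(** * The Brunn-Minkowski inequality on the line *)

Section brunn_minkowski.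
Context {R : realType}.
Local Notation mu := (@lebesgue_measure R).
Local Notation RR := (measurableTypeR R).

Lemma lebesgue_measure_shift c (A : set R) : measurable (A : set RR) ->
  mu ((fun x => x + c) @^-1` A) = mu A.
Proof.
move=> mA; rewrite [RHS](@lebesgue_measure_affine _ 1 c) ?oner_neq0// normr1 mul1e.
by congr (mu _); apply/seteqP; split => x /=; rewrite mulr1.
Qed.

Lemma measurable_shift c (A : set R) : measurable (A : set RR) ->
  measurable ((fun x => x + c) @^-1` A : set RR).
Proof.
move=> mA; rewrite -[X in measurable X]setTI.
have mf : measurable_fun [set: RR] (fun x : RR => x + c : RR).
  exact: measurable_funD.
exact: mf.
Qed.

(** For sets that contain their endpoints. With i the head of the list and sa
    the sum of the left endpoints of the tail, the sums contain A i + sa, which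
    lies to the left of b i + sa, and b i + (the sums of the tail), which lies to
    the right of it. The two parts share at most that point, which is removed
    from the first one, and the induction hypothesis bounds the second one. *)
Lemma brunn_minkowski_itv (I : eqType) (r : seq I) (a b : I -> R)
    (A : I -> set R) (C : set R) : uniq r ->
  (forall i, measurable (A i : set RR)) -> measurable (C : set RR) ->
  (forall i, A i (a i)) -> (forall i, A i (b i)) ->
  (forall i, A i `<=` `[a i, b i]) ->
  (forall x : I -> R, (forall i, A i (x i)) -> C (\sum_(i <- r) x i)) ->
  (\sum_(i <- r) mu (A i) <=
   mu (C `&` `[(\sum_(i <- r) a i)%R, (\sum_(i <- r) b i)%R]%classic))%E.
Proof.
move=> ur mA mC Aa Ab Aab.
elim: r ur C mC => [|i r IH] /= ur C mC hC; first by rewrite big_nil.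
case/andP: ur => ir ur; rewrite !big_cons.
set sa := \sum_(j <- r) a j; set sb := \sum_(j <- r) b j.
have sab : sa <= sb.
  by apply: ler_sum => j _; have /andP[] := Aab j _ (Aa j).
have ai_bi : a i <= b i by have /andP[] := Aab i _ (Aa i).
(* C' contains the sums of the tail. *)
pose C' := (fun x => x + b i) @^-1` C.
have mC' : measurable (C' : set RR) by exact: measurable_shift.
have {}IH : (\sum_(j <- r) mu (A j) <= mu (C' `&` `[sa, sb]%classic))%E.
  apply: IH => // x Ax; rewrite /C' /=.
  have := hC (fun j => if j == i then b i else x j).
  rewrite big_cons eqxx addrC big_seq_cond.
  rewrite (eq_bigr x) => [|j /andP[jr _]]; last first.
    by case: eqP => // ji; rewrite ji (negbTE ir) in jr.
  rewrite -big_seq_cond; apply => j; case: eqP => // ->; exact: Ab.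
pose X1 := (fun x => x + - sa) @^-1` (A i `\ b i).
pose X2 := (fun x => x + - b i) @^-1` (C' `&` `[sa, sb]%classic).
have mX1 : measurable (X1 : set RR) by apply: measurable_shift; exact: measurableD.
have mX2 : measurable (X2 : set RR).
  by apply: measurable_shift; exact: measurableI.
have mX1E : mu X1 = mu (A i `\ b i) by apply: lebesgue_measure_shift; exact: measurableD.
have mX2E : mu X2 = mu (C' `&` `[sa, sb]%classic).
  by apply: lebesgue_measure_shift; exact: measurableI.
have muA : (mu (A i) <= mu X1)%E.
  rewrite mX1E -[X in (X <= _)%E](_ : mu ((A i `\ b i) `|` [set b i]) = _)%E; last first.
    congr (mu _); apply/seteqP; split => x /=; first by move=> [[]//|->]; exact: Ab.
    by move=> Aix; have [->|/eqP] := eqVneq x (b i); [right|left].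
  rewrite -[leRHS]adde0 -[X in (_ + X)%E](lebesgue_measure_set1 (b i)).
  by apply: measureU2 => //; exact: measurableD.
apply: (@le_trans _ _ (mu X1 + mu X2)%E).
  by rewrite leeD// mX2E.
rewrite -measureU//; last first.
  apply/seteqP; split => x //= -[[Ax xb] [_]].
  rewrite /= in_itv /= => /andP[x1 _]; apply: xb.
  have := Aab i _ Ax; rewrite /= in_itv /= => /andP[_ x2].
  by apply/eqP; rewrite eq_le x2/=; lra.
apply: le_measure; rewrite ?inE.
- exact: measurableU.
- exact: measurableI.
move=> x /= [[Ax xb]|].
  split; last first.
    by have := Aab i _ Ax; rewrite /= !in_itv /= => /andP[? ?]; apply/andP; split; lra.
  have := hC (fun j => if j == i then x - sa else a j).
  rewrite big_cons eqxx big_seq_cond.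
  rewrite (eq_bigr a) => [|j /andP[jr _]]; last first.
    by case: eqP => // ji; rewrite ji (negbTE ir) in jr.
  rewrite -big_seq_cond -/sa subrK; apply => j; case: eqP => // ->; exact: Ax.
rewrite /X2 /= /C' /= subrK => -[Cx]; rewrite !in_itv /= => /andP[? ?].
by split => //; apply/andP; split; lra.
Qed.

(** The endpoints are the extremal points of a compact subset of A of almost
    full measure; if that subset is empty, any point of A will do. *)
Lemma inner_itv_approx (A : set R) (e : R) : measurable (A : set RR) ->
  (mu A < +oo)%E -> A !=set0 -> 0 < e ->
  exists a b, [/\ A a, A b & (mu A <= mu (A `&` `[a, b]%classic) + e%:E)%E].
Proof.
move=> mA Aoo [c Ac] e0.
have [K [cK KA AK]] := lebesgue_regularity_inner mA Aoo e0.
have mK : measurable (K : set RR) by apply: closed_measurable; exact: compact_closed.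
have muA (B : set R) : measurable (B : set RR) -> K `<=` B -> B `<=` A ->
    (mu A <= mu B + e%:E)%E.
  move=> mB KB BA; rewrite -(setDUK BA) measureU//; last 2 first.
  - exact: measurableD.
  - by apply/seteqP; split => x //= [? []].
  rewrite leeD2l// (le_trans _ (ltW AK))// le_measure// ?inE.
  - exact: measurableD.
  - exact: measurableD.
  - by move=> x /= [? nB]; split => // /KB.
have [K0|/set0P K0] := eqVneq K set0.
  exists c, c; split => //; apply: muA; first exact: measurableI.
  - by rewrite K0.
  - by move=> x [].
have cid : {within K, continuous (@id R)} by apply: continuous_subspaceT => x; exact: cvg_id.
have [b /set_mem Kb hb] := compact_EVT_max K0 cK cid.
have [a /set_mem Ka ha] := compact_EVT_min K0 cK cid.
exists a, b; split; [exact: KA|exact: KA|].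
apply: muA; first exact: measurableI.
- by move=> x Kx; split; [exact: KA|rewrite /= in_itv/= ha ?hb ?inE].
- by move=> x [].
Qed.

(** The set of sums need not be measurable, hence the measurable superset C. If C
    has finite measure then so has each A i, a translate of which lies in C; A i
    can then be cut down to a set that contains its endpoints, at an arbitrarily
    small cost. *)
Lemma brunn_minkowski1 (I : eqType) (r : seq I) (A : I -> set R) (C : set R) :
  uniq r ->
  (forall i, measurable (A i : set RR)) -> measurable (C : set RR) ->
  (forall i, A i !=set0) ->
  (forall x : I -> R, (forall i, A i (x i)) -> C (\sum_(i <- r) x i)) ->
  (\sum_(i <- r) mu (A i) <= mu C)%E.
Proof.
move=> ur mA mC A0 hC.
have [Coo|] := ltP (mu C) +oo%E; last by rewrite leye_eq => /eqP ->; rewrite leey.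
have [x Ax] := choice A0.
have Aoo i : i \in r -> (mu (A i) < +oo)%E.
  move=> ir; apply: le_lt_trans Coo.
  pose s := \sum_(j <- r | j != i) x j.
  rewrite -(lebesgue_measure_shift (- s) (mA i)).
  apply: le_measure; rewrite ?inE//; first exact: measurable_shift.
  move=> y /= Ay; have := hC (fun j => if j == i then y - s else x j).
  rewrite (bigD1_seq i)//= eqxx (eq_bigr x); last by move=> j /negbTE ->.
  by rewrite subrK; apply => j; case: eqP => // ->.
apply/lee_addgt0Pr => e e0.
(* The successor avoids a division by zero when r is empty. *)
pose d := e / (size r).+1%:R.
have d0 : 0 < d by rewrite divr_gt0.
have /choice[ab Hab] : forall i, exists ab : R * R, [/\ A i ab.1, A i ab.2 &
   i \in r -> (mu (A i) <= mu (A i `&` `[ab.1, ab.2]%classic) + d%:E)%E].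
  move=> i; case: (boolP (i \in r)) => ir; last by exists (x i, x i).
  have [a [b [? ? ?]]] := inner_itv_approx (mA i) (Aoo i ir) (A0 i) d0.
  by exists (a, b).
(* The two points need not be ordered. *)
pose a i := Num.min (ab i).1 (ab i).2; pose b i := Num.max (ab i).1 (ab i).2.
have aleb i : a i <= b i by rewrite /a /b; case: (leP (ab i).1 (ab i).2) => // /ltW.
have [Aa Ab] : (forall i, A i (a i)) /\ (forall i, A i (b i)).
  by split=> i; have [? ? _] := Hab i; rewrite /a /b; case: leP.
apply: (@le_trans _ _ (\sum_(i <- r) (mu (A i `&` `[a i, b i]%classic) + d%:E))%E).
  rewrite big_seq [leRHS]big_seq; apply: lee_sum => i ir.
  have [_ _ /(_ ir) h] := Hab i; apply: (le_trans h); rewrite leeD2r// le_measure// ?inE.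
  - exact: measurableI.
  - exact: measurableI.
  - apply: setIS => y /=; rewrite !in_itv /= /a /b => /andP[ya yb].
    by rewrite ge_min le_max ya yb orbT.
rewrite big_split /= leeD//; last first.
  rewrite sumEFin lee_fin big_const_seq count_predT iter_addr addr0.
  rewrite /d -[_ *+ _]mulr_natr -mulrA ger_pMr// mulrC ler_pdivrMr// mul1r ler_nat //.
apply: (@le_trans _ _ (mu (C `&`
    `[(\sum_(i <- r) a i)%R, (\sum_(i <- r) b i)%R]%classic))).
  apply: brunn_minkowski_itv => //.
  - by move=> i; exact: measurableI.
  - by move=> i; split; [exact: Aa|rewrite /= in_itv /= lexx aleb].
  - by move=> i; split; [exact: Ab|rewrite /= in_itv /= lexx aleb].
  - by move=> y Ay; apply: hC => i; have [] := Ay i.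
by apply: le_measure; rewrite ?inE//; exact: measurableI.
Qed.

End brunn_minkowski.

(** * The Prekopa-Leindler inequality for several functions *)

Section layer_cake.
Context d (T : measurableType d) (R : realType).
Variable m : {sigma_finite_measure set T -> \bar R}.
Local Notation mu := (@lebesgue_measure R).
Local Open Scope ereal_scope.

(** Tonelli for the region under the graph of f. The condition 0 <= t is part of
    the set, so that the integral over t runs over the whole line. *)
Lemma layer_cake (f : T -> \bar R) : measurable_fun setT f ->
  (forall x, 0 <= f x) ->
  measurable_fun [set: measurableTypeR R]
    (fun t => m [set x | (0 <= t)%R /\ t%:E < f x]) /\
  \int[m]_x f x = \int[mu]_t m [set x | (0 <= t)%R /\ t%:E < f x].
Proof.
move=> mf f0.
pose E : set (T * measurableTypeR R) := [set p | (0 <= p.2)%R /\ p.2%:E < f p.1].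
have mE : measurable E.
  have -> : E = (setT `*` `[0%R, +oo[%classic) `&` (setT `&` [set p | p.2%:E < f p.1]).
    apply/seteqP; split => -[x t] /=; rewrite in_itv /= andbT; first by move=> [].
    by move=> [[_ ?] [_ ?]].
  apply: measurableI; first exact: measurableX.
  apply: measurable_lte => //; first by apply/measurable_EFinP; exact: measurable_snd.
  exact: (measurableT_comp mf (@measurable_fst _ _ _ _)).
have yE t : ysection E t = [set x | (0 <= t)%R /\ t%:E < f x].
  by apply/seteqP; split => x; rewrite /ysection /= inE.
split.
  have := @measurable_fun_ysection _ _ _ _ _ m _ mE.
  rewrite (_ : _ \o _ = fun t => m [set x | (0 <= t)%R /\ t%:E < f x])//.
  by apply/funext => t /=; rewrite yE.
have := @indic_fubini_tonelli _ _ _ _ _ m mu _ mE.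
rewrite indic_fubini_tonelli_FE// indic_fubini_tonelli_GE// => h.
transitivity (\int[mu]_y (m \o ysection E) y); last first.
  by apply: eq_integral => t _ /=; rewrite yE.
rewrite -h; apply: eq_integral => x _ /=.
rewrite (_ : xsection E x = [set t | (0 <= t)%R /\ t%:E < f x]); last first.
  by apply/seteqP; split => t; rewrite /xsection /= inE.
have := f0 x; case: (f x) => [r| |] //.
  rewrite lee_fin => r0.
  rewrite (_ : [set _ | _] = `[0%R, r[%classic); last first.
    by apply/seteqP; split => t; rewrite /= in_itv /= lte_fin; [move=> [-> ->]|case/andP].
  rewrite lebesgue_measure_itv /= lte_fin; case: ltgtP r0 => // [r0|<-] _;
    last by [].
  by rewrite -EFinB subr0.
move=> _; rewrite (_ : [set _ | _] = `[0%R, +oo[%classic); last first.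
  by apply/seteqP; split => t; rewrite /= in_itv /= andbT ltry; [case|].
by rewrite lebesgue_measure_itv /= ltry.
Qed.

End layer_cake.

Section weighted_AMGM.
Context {R : realType} (I : eqType).
Implicit Types (r : seq I) (P : pred I) (p : I -> R).

(** Multiply the p i-th powers of the inequalities a i / A <= exp (a i / A - 1),
    A being the weighted mean: the exponents on the right add up to zero. *)
Lemma powR_prod_le_sum r P p (a : I -> R) : (forall i, 0 < p i) ->
  \sum_(i <- r | P i) p i = 1 -> (forall i, 0 <= a i) ->
  \prod_(i <- r | P i) a i `^ p i <= \sum_(i <- r | P i) p i * a i.
Proof.
move=> p0 p1 a0.
set A := \sum_(i <- r | P i) _.
have A0 : 0 <= A by apply: sumr_ge0 => i _; rewrite mulr_ge0// ltW.
have [A00|An0] := eqVneq A 0.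
  have /eqP := A00; rewrite /A psumr_eq0 => [|i _]; last by rewrite mulr_ge0// ltW.
  rewrite -/A A00; elim: r p1 {A A0 A00} => [|i r IH].
    by move=> p1; case: (elimN eqP (oner_neq0 R)); rewrite -p1 big_nil.
  rewrite !big_cons /=; case: ifPn => Pi; last by move=> /= /IH.
  move=> _ /= /andP[]; rewrite mulf_eq0 gt_eqF//= => /eqP ai _.
  by rewrite ai powR0 ?mul0r ?gt_eqF.
have {A0 An0}A0 : 0 < A by rewrite lt_neqAle eq_sym An0.
have aE i : a i `^ p i <= A `^ p i * expR (p i * (a i / A - 1)).
  rewrite -[X in X `^ _ <= _](divfK (lt0r_neq0 A0)).
  have q0 : 0 <= a i / A by rewrite divr_ge0// ltW.
  rewrite powRM//; last exact: ltW.
  rewrite mulrC ler_wpM2l ?powR_ge0//.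
  rewrite [p i * _]mulrC expRM ge0_ler_powR ?nnegrE ?expR_ge0//; first exact: ltW.
  by rewrite (le_trans _ (expR_ge1Dx _))// addrC subrK.
apply: (@le_trans _ _ (\prod_(i <- r | P i) (A `^ p i * expR (p i * (a i / A - 1))))).
  by apply: ler_prod => i _; rewrite powR_ge0 aE.
rewrite big_split /= -expR_sum.
have -> : \sum_(i <- r | P i) p i * (a i / A - 1) = 0.
  under eq_bigr do rewrite mulrBr mulrA mulr1.
  by rewrite sumrB -mulr_suml p1 -/A divff ?subrr// gt_eqF.
rewrite expR0 mulr1 (eq_bigr (fun i => expR (p i * ln A))) => [|i _].
  by rewrite -expR_sum -mulr_suml p1 mul1r lnK.
by rewrite /powR gt_eqF.
Qed.

Local Open Scope ereal_scope.

Lemma poweR_prod_le_sum (r : seq I) (P : pred I) (p : I -> R) (a : I -> \bar R) :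
  (forall i, 0 < p i)%R ->
  (\sum_(i <- r | P i) p i = 1)%R -> (forall i, 0 <= a i) ->
  \prod_(i <- r | P i) a i `^ p i <= \sum_(i <- r | P i) (p i)%:E * a i.
Proof.
move=> p0 p1 a0.
have [|afin] := boolP (has (fun i => P i && (a i == +oo)) r).
  move=> /hasP[i ir /andP[Pi /eqP ai]].
  rewrite [leRHS](_ : _ = +oo) ?leey//.
  apply/eqP; rewrite -leye_eq (big_rem i)//= Pi ai gt0_muley ?lte_fin// addye ?leey//.
  rewrite gt_eqF// (lt_le_trans ltNy0)// sume_ge0// => j _.
  by rewrite mule_ge0// lee_fin ltW.
have aE i : i \in r -> P i -> a i = (fine (a i))%:E.
  move=> ir Pi; rewrite fineK// ge0_fin_numE// lt_neqAle leey andbT.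
  by move/hasPn/(_ i ir) : afin; rewrite Pi.
rewrite big_seq_cond [leRHS]big_seq_cond.
rewrite (eq_bigr (fun i => (fine (a i) `^ p i)%:E)) => [|i /andP[ir Pi]]; last first.
  by rewrite [in LHS]aE.
rewrite [leRHS](eq_bigr (fun i => (p i * fine (a i))%:E)) => [|i /andP[ir Pi]]; last first.
  by rewrite [in LHS]aE.
rewrite -big_seq_cond -[in leRHS]big_seq_cond prodEFin sumEFin lee_fin.
by apply: powR_prod_le_sum => // i; rewrite fine_ge0.
Qed.
End weighted_AMGM.

Section normalized_prekopa_leindler.
Context {R : realType} (I : eqType).
Local Notation mu := (@lebesgue_measure R).
Local Notation RR := (measurableTypeR R).
Implicit Types (r : seq I) (p : I -> R).

Lemma powR_prod_gt r p (a : I -> R) (t : R) : (forall i, 0 < p i) ->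
  \sum_(i <- r) p i = 1 -> 0 <= t -> (forall i, t < a i) ->
  t < \prod_(i <- r) a i `^ p i.
Proof.
move=> p0 p1 t0 ta.
have tE : t = \prod_(i <- r) t `^ p i.
  have [->|tn0] := eqVneq t 0.
    case: r p1 => [|i r]; last by rewrite big_cons powR0 ?mul0r// gt_eqF.
    by move=> p1; case: (elimN eqP (oner_neq0 R)); rewrite -p1 big_nil.
  have {tn0}t0 : 0 < t by rewrite lt_neqAle eq_sym tn0.
  rewrite (eq_bigr (fun i => expR (p i * ln t))) => [|i _].
    by rewrite -expR_sum -mulr_suml p1 mul1r lnK.
  by rewrite /powR gt_eqF.
rewrite {1}tE.
have : r != [::].
  case: r p1 {tE} => // p1; case: (elimN eqP (oner_neq0 R)).
  by rewrite -p1 big_nil.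
have lt1 i : t `^ p i < a i `^ p i.
  by rewrite gt0_ltr_powR// nnegrE// ltW// (le_lt_trans t0).
elim: r {p1 tE} => // i [|j r] IH _; first by rewrite !big_seq1.
rewrite !(big_cons _ _ i) ltr_pM// ?powR_ge0//.
  by apply: prodr_ge0 => k _; exact: powR_ge0.
exact: IH.
Qed.

Local Open Scope ereal_scope.

(** Since each g i reaches its upper bound 1, the sets {g i > t} are nonempty for
    t < 1, and their weighted sums lie in {F > t}. The Brunn-Minkowski inequality
    for these sets, integrated over t, bounds from below the integral of F by the
    weighted arithmetic mean of the integrals of the g i, hence by their weighted
    geometric mean. *)
Lemma prekopa_leindler_normalized r p (g : I -> R -> R) (F : R -> \bar R) :
  uniq r -> (forall i, 0 < p i)%R -> (\sum_(i <- r) p i = 1)%R ->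
  (forall i, measurable_fun [set: RR] (g i : RR -> R)) ->
  (forall i x, 0 <= g i x <= 1)%R -> (forall i, exists x, g i x = 1%R) ->
  measurable_fun [set: RR] (F : RR -> \bar R) -> (forall x, 0 <= F x) ->
  (forall x : I -> R, (\prod_(i <- r) g i (x i) `^ p i)%:E
     <= F (\sum_(i <- r) p i * x i)%R) ->
  \prod_(i <- r) (\int[mu]_x (g i x)%:E) `^ p i <= \int[mu]_x F x.
Proof.
move=> ur p0 p1 mg g01 g1 mF F0 gF.
have ig0 i : 0 <= \int[mu]_x (g i x)%:E.
  by apply: integral_ge0 => x _; rewrite lee_fin; case/andP: (g01 i x).
apply: (le_trans (poweR_prod_le_sum p0 p1 ig0)).
have mg' i : measurable_fun [set: RR] (fun x : RR => (g i x)%:E).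
  by apply/measurable_EFinP.
have g0' i x : 0 <= (g i x)%:E by rewrite lee_fin; case/andP: (g01 i x).
have [mFt ->] := layer_cake mu mF F0.
have lcg i := layer_cake mu (mg' i) (g0' i).
rewrite (eq_bigr (fun i => \int[mu]_t ((p i)%:E *
    mu [set x | (0 <= t)%R /\ t%:E < (g i x)%:E]))); last first.
  move=> i _; have [mgt ->] := lcg i; rewrite ge0_integralZl//.
  by rewrite lee_fin ltW.
rewrite -ge0_integral_sum//; last 2 first.
- by move=> i; apply: measurable_funeM; have [] := lcg i.
- by move=> i t _; rewrite mule_ge0// lee_fin ltW.
apply: ge0_le_integral => //.
- by move=> t _; apply: sume_ge0 => i _; rewrite mule_ge0// lee_fin ltW.
- apply: emeasurable_sum => i; apply: measurable_funeM; by have [] := lcg i.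
move=> t _.
have [t0|t0] : (t < 0 \/ 0 <= t)%R by case: (ltP t 0%R); [left|right].
  rewrite big1 ?measure_ge0// => i _.
  rewrite (_ : [set _ | _] = set0) ?measure0 ?mule0//.
  by apply/seteqP; split => x //= -[]; rewrite leNgt t0.
have [t1|t1] : (1 <= t \/ t < 1)%R by case: (leP 1%R t); [left|right].
  rewrite big1 ?measure_ge0// => i _.
  rewrite (_ : [set _ | _] = set0) ?measure0 ?mule0//.
  apply/seteqP; split => x //= -[_]; rewrite lte_fin.
  by case/andP: (g01 i x) => ? ? ?; lra.
pose A i : set R := (fun y => (y * (p i)^-1 + 0)%R) @^-1` [set x | (t < g i x)%R].
have mB i : measurable ([set x | (t < g i x)%R] : set RR).
  rewrite -[X in measurable X]setTI.
  have := measurable_lte measurableT (measurable_cst t%:E) (mg' i).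
  by congr (measurable (_ `&` _)); apply/seteqP; split => x /=; rewrite lte_fin.
have mA i : measurable (A i : set RR).
  rewrite -[X in measurable X]setTI.
  exact: (measurable_affine (p i)^-1 0 measurableT (mB i)).
have muA i : (p i)%:E * mu [set x | (0 <= t)%R /\ t%:E < (g i x)%:E] = mu (A i).
  rewrite (_ : [set _ | _] = [set x | (t < g i x)%R]); last first.
    by apply/seteqP; split => x /=; rewrite lte_fin// => -[].
  rewrite (@lebesgue_measure_affine _ (p i)^-1 0)//; last by rewrite invr_neq0// gt_eqF.
  rewrite muleA -EFinM gtr0_norm ?invr_gt0// divff ?mul1e// gt_eqF//.
rewrite (eq_bigr (fun i => mu (A i))); last by move=> i _; exact: muA.
apply: brunn_minkowski1 => //.
- have := measurable_lte measurableT (measurable_cst t%:E) mF.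
  by congr (measurable _); apply/seteqP; split => x /= [_ h].
- move=> i; have [x gx] := g1 i; exists (x * p i)%R; rewrite /A /=.
  by rewrite addr0 mulfK ?gx// gt_eqF.
move=> x Ax; split => //.
have := gF (fun i => x i / p i)%R.
rewrite [X in F X](_ : _ = \sum_(i <- r) x i)%R; last first.
  by apply: eq_bigr => i _; rewrite mulrCA divff ?mulr1// gt_eqF.
apply: lt_le_trans; rewrite lte_fin; apply: powR_prod_gt => // i.
by have := Ax i; rewrite /A /= addr0.
Qed.

End normalized_prekopa_leindler.

Section poweR_sup.
Context {R : realType}.
Local Open Scope ereal_scope.
Implicit Types (K B : \bar R).

Lemma lee_prod (I : Type) (r : seq I) (P : pred I) (f g : I -> \bar R) :
  (forall i, P i -> 0 <= f i <= g i) ->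
  \prod_(i <- r | P i) f i <= \prod_(i <- r | P i) g i.
Proof.
move=> fg; suff /andP[] : 0 <= \prod_(i <- r | P i) f i <=
    \prod_(i <- r | P i) g i by [].
elim/big_ind2 : _ => // [|x1 x2 y1 y2 /andP[x10 x12] /andP[y10 y12]].
  by rewrite lee01 lexx.
by rewrite mule_ge0//= lee_pmul.
Qed.

(** For finite positive K and B the bound K y^p <= B is a bound on y. If K is
    infinite and B is finite, every element of A is 0. *)
Lemma le_mul_poweR_ereal_sup (A : set \bar R) K B (p : R) :
  (0 < p)%R -> 0 <= K -> A !=set0 -> (forall y, A y -> 0 <= y) ->
  (forall y, A y -> K * y `^ p <= B) -> K * (ereal_sup A) `^ p <= B.
Proof.
move=> p0 K0 [y0 Ay0] A0 hA.
have B0 : 0 <= B by rewrite (le_trans _ (hA _ Ay0))// mule_ge0// poweR_ge0.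
have sA0 : 0 <= ereal_sup A by rewrite (le_trans (A0 _ Ay0))// ereal_sup_ubound.
have pn0 : p != 0%R by rewrite gt_eqF.
have [->|Kn0] := eqVneq K 0; first by rewrite mul0e.
have {Kn0}K_gt0 : 0 < K by rewrite lt_neqAle eq_sym Kn0.
have H b : (0 <= b)%R -> (forall y, A y -> y `^ p <= b%:E) ->
    ereal_sup A `^ p <= b%:E.
  move=> b0 Ab.
  have bE : b%:E = (b `^ p^-1)%:E `^ p.
    by rewrite poweR_EFin -powRrM mulVf// powRr1.
  rewrite bE gt0_ler_poweR ?(ltW p0)//.
  - by rewrite in_itv /= sA0 leey.
  - by rewrite in_itv /= lee_fin powR_ge0 leey.
  apply: ge_ereal_sup => y Ay.
  have -> : y = (y `^ p) `^ p^-1 by rewrite -poweRrM mulfV// poweRe1// A0.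
  rewrite -poweR_EFin gt0_ler_poweR ?Ab//.
  - by rewrite invr_ge0 ltW.
  - by rewrite in_itv /= poweR_ge0 leey.
  - by rewrite in_itv /= lee_fin b0 leey.
case: B B0 hA => [b|_ _|//]; last by rewrite leey.
rewrite lee_fin => b0.
case: K K0 K_gt0 => [k| |//]; last first.
  move=> _ _ hA.
  have A00 y : A y -> y `^ p <= 0%:E.
    move=> Ay; have := hA _ Ay; rewrite leNgt; apply: contraNT; rewrite -ltNge => yp.
    by rewrite gt0_mulye// ltry.
  have h := H _ (lexx 0%R) A00.
  by rewrite (_ : _ `^ _ = 0) ?mule0 ?lee_fin//; apply/eqP; rewrite eq_le poweR_ge0 h.
rewrite lte_fin => _ k0 hA; rewrite -lee_pdivlMl//; apply: H.
  by rewrite mulr_ge0// invr_ge0 ltW.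
by move=> y Ay; rewrite EFinM lee_pdivlMl//; exact: hA.
Qed.

(** The factors are replaced by their suprema one at a time. *)
Lemma le_prod_poweR_ereal_sup (I : eqType) (r : seq I) (A : I -> set \bar R)
    K B (p : I -> R) : uniq r ->
  (forall i, 0 < p i)%R -> 0 <= K -> (forall i, A i !=set0) ->
  (forall i y, A i y -> 0 <= y) ->
  (forall y : I -> \bar R, (forall i, A i (y i)) ->
     K * \prod_(i <- r) y i `^ p i <= B) ->
  K * \prod_(i <- r) ereal_sup (A i) `^ p i <= B.
Proof.
move=> ur p0 K0 A0 Age0.
have [y0 Ay0] := choice A0.
elim: r ur K K0 => [_|i r IH /= /andP[ir ur]] K K0 hK.
  by have := hK _ Ay0; rewrite !big_nil.
rewrite big_cons; set P := \prod_(j <- r) _; rewrite [_ * P]muleC muleA.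
apply: le_mul_poweR_ereal_sup => //; last 2 first.
- exact: Age0.
- move=> y Ay; rewrite -muleA [P * _]muleC muleA.
  apply: IH => //; first by rewrite mule_ge0// poweR_ge0.
  move=> z Az.
  have := hK (fun j => if j == i then y else z j).
  rewrite big_cons eqxx big_seq_cond.
  rewrite (eq_bigr (fun j => z j `^ p j)) => [|j /andP[jr _]]; last first.
    by case: eqP => // ji; rewrite ji (negbTE ir) in jr.
  by rewrite -big_seq_cond muleA; apply => j; case: eqP => // ->.
by rewrite mule_ge0//; apply: prode_ge0 => j _; exact: poweR_ge0.
Qed.

Lemma le_mul_fin_approx K B (c : \bar R) : 0 <= K -> 0 <= c -> 0 <= B ->
  (forall c', (0 < c')%R -> c'%:E <= c -> c'%:E * K <= B) -> c * K <= B.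
Proof.
move=> K0 c0 B0 hc.
case: c c0 hc => [c| |//].
  rewrite lee_fin le_eqVlt => /predU1P[<-|c0]; first by rewrite mul0e.
  by apply.
move=> _ hc; have [->|Kn0] := eqVneq K 0; first by rewrite mule0.
have {Kn0}K_gt0 : 0 < K by rewrite lt_neqAle eq_sym Kn0.
rewrite gt0_mulye//; case: B B0 hc => [b| |//]; last by rewrite leey.
rewrite lee_fin => b0 hc; exfalso.
case: K K0 K_gt0 hc => [k| |//]; last first.
  by move=> _ _ /(_ 1%R ltr01); rewrite leey mul1e => /(_ erefl).
rewrite lte_fin => _ k0 /(_ ((b + 1) / k))%R.
rewrite -EFinM divfK ?gt_eqF// lee_fin leey => h.
have : (b + 1 <= b)%R by apply: h => //; rewrite divr_gt0// ltr_wpDl.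
by rewrite leNgt ltrDl ltr01.
Qed.

End poweR_sup.

Section prekopa_leindler.
Context {R : realType} (I : eqType).
Local Notation mu := (@lebesgue_measure R).
Local Notation RR := (measurableTypeR R).
Implicit Types (r : seq I) (p : I -> R).
Import HBNNSimple.

(** A simple function takes finitely many values, hence reaches its maximum.
    General functions are therefore reduced to their simple minorants rather than
    to truncations, which need not reach their suprema. *)
Lemma nnsfun_normalize d (T : measurableType d) (x0 : T) (h : {nnsfun T >-> R}) :
  (forall x, h x = 0) \/
  exists M (g : T -> R), [/\ 0 < M, measurable_fun setT g, forall x, 0 <= g x <= 1,
    exists x, g x = 1 & forall x, h x = M * g x].
Proof.
have r0 : range h !=set0 by exists (h x0), x0.
have cr : compact (range h) by apply: finite_compact; exact: fimfunP.
have cid : {within range h, continuous (@id R)}.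
  by apply: continuous_subspaceT => x; exact: cvg_id.
have [_ /set_mem[x1 _ <-] hmax] := compact_EVT_max r0 cr cid.
have {}hmax x : h x <= h x1 by apply: hmax; rewrite inE; exists x.
have h0 x : 0 <= h x by exact: fun_ge0.
have [hx10|hx1n0] := eqVneq (h x1) 0.
  by left => x; apply/eqP; rewrite eq_le h0 -hx10 hmax.
have hx1 : 0 < h x1 by rewrite lt_neqAle eq_sym hx1n0 h0.
right; exists (h x1), (fun x => h x / h x1); split => //.
- by apply: measurable_funM.
- by move=> x; rewrite divr_ge0//= ler_pdivrMr// mul1r.
- by exists x1; rewrite divff.
- by move=> x; rewrite mulrC divfK.
Qed.

Local Open Scope ereal_scope.

(** The integral of G i is the supremum of the integrals of the simple functions
    below G i, so that G i may be replaced by a multiple of a normalized function.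
    The constant c is there for the factors that do not depend on the variable of
    integration when the inequality is used one coordinate at a time. *)
Theorem prekopa_leindler r p (G : I -> R -> \bar R) (F : R -> \bar R)
    (c : \bar R) :
  uniq r -> (forall i, 0 < p i)%R -> (\sum_(i <- r) p i = 1)%R ->
  (forall i x, 0 <= G i x) -> 0 <= c ->
  measurable_fun [set: RR] (F : RR -> \bar R) -> (forall x, 0 <= F x) ->
  (forall x : I -> R, c * \prod_(i <- r) G i (x i) `^ p i
     <= F (\sum_(i <- r) p i * x i)%R) ->
  c * \prod_(i <- r) (\int[mu]_x G i x) `^ p i <= \int[mu]_x F x.
Proof.
move=> ur p0 p1 G0 c0 mF F0 GF.
have ple0 i : (0 <= p i)%R by exact: ltW.
have iF0 : 0 <= \int[mu]_x F x by exact: integral_ge0.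
apply: le_mul_fin_approx => //; first by apply: prode_ge0 => i _; exact: poweR_ge0.
move=> C C0 Cc.
pose A i := [set sintegral mu h | h in [set h : {nnsfun RR >-> R} |
   forall x, (h x)%:E <= G i x]].
rewrite (eq_bigr (fun i => ereal_sup (A i) `^ p i)) => [|i _]; last first.
  by rewrite ge0_integralTE.
apply: le_prod_poweR_ereal_sup => //.
- by rewrite lee_fin ltW.
- by move=> i; exists (sintegral mu (@nnsfun0 _ RR R)), (@nnsfun0 _ RR R) => //= x.
- by move=> i _ [h _ <-]; exact: sintegral_ge0.
move=> y /(_ _)/cid2-/all_sig2[h hG hy].
have [[i ir hi0]|hn0] := pselect (exists2 i, i \in r & forall x, h i x = 0%R).
  rewrite (big_rem i)//= (_ : y i = 0) ?poweR0r ?gt_eqF// ?mul0e ?mule0//.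
  by rewrite -hy (eq_sintegral (cst 0%R))// sintegral0.
have /choice[M /choice[g Mg]] : forall i, exists (M : R) (g : R -> R),
    [/\ (0 < M)%R, measurable_fun [set: RR] (g : RR -> R), (forall x, 0 <= g x <= 1)%R,
    exists x, g x = 1%R & i \in r -> forall x, h i x = (M * g x)%R].
  move=> i; case: (boolP (i \in r)) => ir; last first.
    exists 1%R, (cst 1%R); split => //; first by move=> x; rewrite lexx ler01.
    by exists 0%R.
  have [hi0|[M [g [? ? ? ? ?]]]] := nnsfun_normalize (0%R : RR) (h i).
    by exfalso; apply: hn0; exists i.
  by exists M, g; split.
pose D := (C * \prod_(i <- r) M i `^ p i)%R.
have D0 : (0 < D)%R.
  by rewrite mulr_gt0// prodr_gt0// => i _; rewrite powR_gt0//; have [] := Mg i.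
have Dn0 : D != 0%R by rewrite gt_eqF.
have mg i : measurable_fun [set: RR] (g i : RR -> R) by have [] := Mg i.
have g01 i x : (0 <= g i x <= 1)%R by have [_ _ ->] := Mg i.
have M0 i : (0 < M i)%R by have [] := Mg i.
have DF0 x : 0 <= (D^-1)%:E * F x by rewrite mule_ge0// lee_fin invr_ge0 ltW.
have key : \prod_(i <- r) (\int[mu]_x (g i x)%:E) `^ p i <=
    \int[mu]_x ((D^-1)%:E * F x).
  apply: prekopa_leindler_normalized => //; first by move=> i; have [] := Mg i.
    exact: measurable_funeM.
  move=> x; rewrite lee_pdivlMl//; apply: le_trans (GF x).
  rewrite -EFinM /D -mulrA -big_split EFinM lee_pmul ?lee_fin//.
  - exact: ltW.
  - by apply: prodr_ge0 => i _; rewrite mulr_ge0// powR_ge0.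
  rewrite -prodEFin big_seq [leRHS]big_seq; apply: lee_prod => i ir.
  have [Mi0 _ gi _ hi] := Mg i; have /andP[gi0 _] := gi (x i).
  rewrite /= -powRM -?hi// ?(ltW Mi0)// -poweR_EFin.
  rewrite poweR_ge0 gt0_ler_poweR ?(ltW (p0 i))//.
  - by rewrite in_itv /= lee_fin leey andbT fun_ge0.
  - by rewrite in_itv /= leey andbT.
  - exact: hG.
rewrite [leLHS](_ : _ = D%:E * \prod_(i <- r) (\int[mu]_x (g i x)%:E) `^ p i).
  rewrite -[leRHS](_ : D%:E * ((D^-1)%:E * \int[mu]_x F x) = _); last first.
    by rewrite muleA -EFinM divff// mul1e.
  by rewrite lee_pmul2l// -ge0_integralZl// lee_fin invr_ge0 ltW.
rewrite EFinM -muleA -prodEFin -big_split; congr (_ * _).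
rewrite [LHS]big_seq [RHS]big_seq; apply: eq_bigr => i ir /=.
have [Mi0 mgi gi _ hi] := Mg i.
have g0 x : 0 <= (g i x)%:E by have /andP[? _] := gi x; rewrite lee_fin.
rewrite -poweR_EFin -poweRM ?lee_fin ?(ltW Mi0) ?integral_ge0//; congr (_ `^ _).
rewrite -hy -integralT_nnsfun -ge0_integralZl//.
- by apply: eq_integral => x _; rewrite hi.
- exact/measurable_EFinP.
- by rewrite lee_fin ltW.
Qed.

End prekopa_leindler.

(** * The Hoelder inequality for several functions *)

Section hoelder_prod.
Context d (T : measurableType d) (R : realType) (I : eqType).
Variable mu : {measure set T -> \bar R}.
Local Open Scope ereal_scope.

Lemma emeasurable_prod (D : set T) (r : seq I) (P : pred I) (f : I -> T -> \bar R) :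
  (forall i, measurable_fun D (f i)) ->
  measurable_fun D (fun x => \prod_(i <- r | P i) f i x).
Proof.
move=> mf; elim: r => [|i r IH].
  by under eq_fun do rewrite big_nil; exact: measurable_cst.
under eq_fun do rewrite big_cons.
by case: (P i) => //; exact: emeasurable_funM.
Qed.

Lemma measurable_fun_poweR (p : R) (f : T -> \bar R) : measurable_fun setT f ->
  measurable_fun setT (fun x => f x `^ p).
Proof. by move=> mf; exact: (measurableT_comp (measurable_poweR p) mf). Qed.

(** Integrate the weighted inequality between geometric and arithmetic means for
    the functions G i divided by their integrals. A vanishing integral makes the
    left-hand side vanish, and otherwise an infinite one makes the right-hand side
    infinite. *)
Theorem hoelder_prod (r : seq I) (p : I -> R) (G : I -> T -> \bar R) :
  (forall i, 0 < p i)%R -> (\sum_(i <- r) p i = 1)%R ->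
  (forall i, measurable_fun setT (G i)) -> (forall i x, 0 <= G i x) ->
  \int[mu]_x (\prod_(i <- r) G i x `^ p i) <=
  \prod_(i <- r) (\int[mu]_x G i x) `^ p i.
Proof.
move=> p0 p1 mG G0.
have iG0 i : 0 <= \int[mu]_x G i x by exact: integral_ge0.
have mP : measurable_fun setT (fun x => \prod_(i <- r) G i x `^ p i).
  by apply: emeasurable_prod => i; exact: measurable_fun_poweR.
have P0 x : 0 <= \prod_(i <- r) G i x `^ p i.
  by apply: prode_ge0 => i _; exact: poweR_ge0.
have [/hasP[i ir /eqP Gi0]|nz] := boolP (has (fun i => \int[mu]_x G i x == 0) r).
  rewrite [leLHS](_ : _ = 0); first by apply: prode_ge0 => j _; exact: poweR_ge0.
  have : ae_eq mu setT (G i) (cst 0).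
    apply/(ae_eq_integral_abs mu measurableT (mG i)).
    by rewrite -[RHS]Gi0; apply: eq_integral => x _; rewrite gee0_abs.
  move=> Gae; rewrite -(integral0 mu setT); apply: ge0_ae_eq_integral => //.
  apply: filterS Gae => x /(_ Logic.I) Gx _.
  by rewrite (big_rem i)//= Gx poweR0r ?gt_eqF// mul0e.
have Gpos i : i \in r -> 0 < \int[mu]_x G i x.
  move=> ir; rewrite lt_neqAle iG0 andbT eq_sym.
  by move/hasPn : nz => /(_ _ ir).
have [/hasP[i ir /eqP Gioo]|noo] := boolP (has (fun i => \int[mu]_x G i x == +oo) r).
  rewrite [leRHS](_ : _ = +oo) ?leey// (big_rem i)//= Gioo poweRyr ?gt_eqF//.
  rewrite gt0_mulye// big_seq; apply: (big_ind (fun x => 0 < x)) => [|x y|j /mem_rem jr].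
  - exact: lte01.
  - exact: mule_gt0.
  - by rewrite poweR_gt0// Gpos.
pose a i := fine (\int[mu]_x G i x).
have aE i : i \in r -> \int[mu]_x G i x = (a i)%:E.
  move=> ir; rewrite fineK// ge0_fin_numE// lt_neqAle leey andbT.
  by move/hasPn : noo => /(_ _ ir).
have a_gt0 i : i \in r -> (0 < a i)%R by move=> ir; rewrite -lte_fin -aE// Gpos.
have C0 : 0 <= \prod_(i <- r) (a i)%:E `^ p i.
  by apply: prode_ge0 => i _; exact: poweR_ge0.
rewrite (eq_integral (fun x => \prod_(i <- r) (a i)%:E `^ p i *
    \prod_(i <- r) ((a i)^-1%:E * G i x) `^ p i)); last first.
  move=> x _; rewrite -big_split [LHS]big_seq [RHS]big_seq; apply: eq_bigr => i ir /=.
  have ai0 := a_gt0 _ ir.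
  rewrite -poweR_EFin -poweRM ?lee_fin ?(ltW ai0)//.
    by rewrite muleA -EFinM divff ?mul1e// gt_eqF.
  by rewrite mule_ge0// lee_fin invr_ge0 ltW.
have aG0 i x : 0 <= ((a i)^-1)%:E * G i x.
  by rewrite mule_ge0// lee_fin invr_ge0 fine_ge0.
have maG i : measurable_fun setT (fun x => ((a i)^-1)%:E * G i x).
  exact: measurable_funeM.
rewrite ge0_integralZl//; last 2 first.
- by apply: emeasurable_prod => i; exact: measurable_fun_poweR.
- by move=> x _; apply: prode_ge0 => i _; exact: poweR_ge0.
rewrite [leRHS](_ : _ = \prod_(i <- r) (a i)%:E `^ p i * 1); last first.
  by rewrite mule1 big_seq [RHS]big_seq; apply: eq_bigr => i ir; rewrite aE.
rewrite lee_wpmul2l//.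
apply: (@le_trans _ _ (\int[mu]_x \sum_(i <- r) (p i)%:E * ((a i)^-1%:E * G i x))).
  apply: ge0_le_integral => //.
  - by move=> x _; apply: prode_ge0 => i _; exact: poweR_ge0.
  - by apply: emeasurable_prod => i; exact: measurable_fun_poweR.
  - by apply: emeasurable_sum => i; exact: measurable_funeM.
  - by move=> x _; exact: poweR_prod_le_sum.
rewrite ge0_integral_sum//; last 2 first.
- by move=> i; exact: measurable_funeM.
- by move=> i x _; rewrite mule_ge0// lee_fin ltW.
rewrite -p1 -sumEFin big_seq [leRHS]big_seq; apply: lee_sum => i ir.
rewrite ge0_integralZl ?lee_fin ?(ltW (p0 i))//.
rewrite ge0_integralZl ?lee_fin ?invr_ge0 ?(ltW (a_gt0 _ ir))//.
by rewrite aE// -[X in _ * X]EFinM mulVf ?mule1// gt_eqF// a_gt0.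
Qed.

End hoelder_prod.

(** * Coordinate subspaces *)

Section span_integral.
Context {R : realType}.
Local Notation mu := (@lebesgue_measure R).
Local Notation leb := (@borel_lebesgue R).
Local Open Scope ereal_scope.

Definition rows_mx n (us : seq 'rV[R]_n) : 'M[R]_(size us, n) :=
  (\matrix_(i < size us) us`_i)%R.

(** Integral over the span of us in the coordinates that us provides: it differs
    from the integral for the Lebesgue measure of the span by the volume of the
    parallelepiped spanned by us. *)
Definition span_int n (us : seq 'rV[R]_n) (f : 'rV[R]_n -> \bar R) :=
  \int[leb (size us)]_t f (t *m rows_mx us).

(** Spares casts between row vectors whose dimensions are only provably equal. *)
Lemma span_intE n (us : seq 'rV[R]_n) d (A : 'M[R]_(d, n)) f : d = size us ->
  (forall i : 'I_d, row i A = us`_i)%R ->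
  span_int us f = \int[leb d]_t f (t *m A).
Proof.
move=> ds; subst d => Aus; apply: eq_integral => t _; congr (f (_ *m _)).
by apply/row_matrixP => i; rewrite rowK Aus.
Qed.

Lemma integral_leb0 (f : 'rV[R]_0 -> \bar R) : \int[leb 0]_t f t = f 0%R.
Proof.
have -> : f = cst (f 0%R).
  by apply/funext => v /=; congr f; apply/rowP => -[].
by rewrite integral_dirac// diracT mul1e.
Qed.

Lemma span_int_nil n (f : 'rV[R]_n -> \bar R) : span_int [::] f = f 0%R.
Proof. by rewrite /span_int integral_leb0 mul0mx. Qed.

Lemma mul_rV_cons n x d (t : 'rV[R]_d) (A : 'M[R]_(d.+1, n)) :
  (rV_cons (x, t) *m A = x *: row ord0 A + t *m (\matrix_i row (lift ord0 i) A))%R.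
Proof.
apply/rowP => k; rewrite !mxE big_ord_recl; congr (_ + _)%R.
  by rewrite rV_consE unlift_none ?mxE.
by apply: eq_bigr => i _; rewrite rV_consE liftK ?mxE.
Qed.

Lemma mul_rV_cons0 n d (t : 'rV[R]_d) (A : 'M[R]_(d, n)) :
  (t *m (\matrix_i rV_cons (0, row i A)) = rV_cons (0, t *m A))%R.
Proof.
apply/rowP => k; rewrite rV_consE mxE.
have E i : (\matrix_i rV_cons (0, row i A))%R i k = rV_cons (0%R, row i A) ord0 k.
  by rewrite mxE.
under eq_bigr do rewrite E rV_consE.
case: unliftP => [j _|_] /=; last by rewrite big1// => i _; rewrite mulr0.
by rewrite mxE; apply: eq_bigr => i _; rewrite mxE.
Qed.

Lemma row_rows_mx n (us : seq 'rV[R]_n) i : row i (rows_mx us) = (us`_i)%R.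
Proof. by rewrite rowK. Qed.

Lemma measurable_span_int d (T : measurableType d) n (us : seq 'rV[R]_n)
    (f : T -> 'rV[R]_n -> \bar R) :
  measurable_fun setT (fun p : T * 'rV[R]_n => f p.1 p.2) ->
  (forall x v, 0 <= f x v) ->
  measurable_fun setT (fun x => span_int us (f x)).
Proof.
move=> mf f0; apply: measurable_fun_leb_integral => //.
apply: (measurableT_comp mf (f := fun p => f p.1 p.2)
  (g := fun p => (p.1, p.2 *m rows_mx us))).
apply: measurable_fun_pair; first exact: measurable_fst.
exact: (measurableT_comp (measurable_mulmx _) (@measurable_snd _ _ _ _)).
Qed.

Lemma span_int_map0 n (us : seq 'rV[R]_n) (f : 'rV[R]_n.+1 -> \bar R) :
  span_int [seq rV_cons (0%R, u) | u <- us] f =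
  span_int us (fun v => f (rV_cons (0%R, v))).
Proof.
rewrite (@span_intE _ _ _ (\matrix_i rV_cons (0, row i (rows_mx us)))%R).
- by apply: eq_integral => t _; rewrite mul_rV_cons0.
- by rewrite size_map.
- by move=> i; rewrite rowK row_rows_mx (nth_map 0%R).
Qed.

Lemma span_int_cons n (us : seq 'rV[R]_n) (f : 'rV[R]_n.+1 -> \bar R) :
  measurable_fun setT f -> (forall v, 0 <= f v) ->
  span_int (rV_cons (1%R, 0%R) :: [seq rV_cons (0%R, u) | u <- us]) f =
  \int[mu]_x span_int us (fun v => f (rV_cons (x, v))).
Proof.
move=> mf f0.
pose B : 'M[R]_(size us, n.+1) := (\matrix_i rV_cons (0, row i (rows_mx us)))%R.
pose A : 'M[R]_((size us).+1, n.+1) :=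
  (\matrix_i if unlift ord0 i is Some j then row j B else rV_cons (1, 0))%R.
rewrite (@span_intE _ _ _ A); last 2 first.
- by rewrite /= size_map.
- move=> i; rewrite rowK; case: unliftP => [j ->|->] //=.
  by rewrite add0n rowK row_rows_mx (nth_map 0%R).
rewrite ge0_integral_leb_cons//; last first.
  exact: (measurableT_comp mf (measurable_mulmx _)).
apply: eq_integral => x _; apply: eq_integral => t _; congr f.
rewrite mul_rV_cons rowK unlift_none.
rewrite (_ : (\matrix_i row (lift ord0 i) A)%R = B); last first.
  by apply/row_matrixP => i; rewrite !rowK liftK ?rowK.
rewrite mul_rV_cons0; apply/rowP => k.
rewrite [LHS]mxE [X in (X + _)%R]mxE !rV_consE.
by case: unliftP => [j _|_]; rewrite /= ?mxE ?mulr0 ?add0r ?mulr1 ?addr0.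
Qed.

End span_integral.

Section coordinates.
Context {R : realType}.
Local Notation mu := (@lebesgue_measure R).
Local Notation leb := (@borel_lebesgue R).

Definition coords n (S : {set 'I_n}) : seq 'rV[R]_n :=
  [seq delta_mx ord0 k | k in S].

Definition tail_set n (S : {set 'I_n.+1}) : {set 'I_n} := [set i | lift ord0 i \in S].

Definition coord_proj n (S : {set 'I_n}) (v : 'rV[R]_n) : 'rV[R]_n :=
  \row_i if i \in S then v ord0 i else 0.

Lemma delta_lift n (k : 'I_n) :
  delta_mx ord0 (lift ord0 k) = rV_cons (0, delta_mx ord0 k) :> 'rV[R]_n.+1.
Proof.
apply/rowP => i; rewrite rV_consE mxE eqxx /=.
by case: unliftP => [j ->|->]; rewrite ?mxE ?(inj_eq lift_inj).
Qed.

Lemma delta0 n : delta_mx ord0 ord0 = rV_cons (1, 0) :> 'rV[R]_n.+1.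
Proof.
apply/rowP => i; rewrite rV_consE mxE eqxx /=.
by case: unliftP => [j ->|->]; rewrite ?mxE ?eqxx// eq_sym (negbTE (neq_lift _ _)).
Qed.

Lemma coords_rec n (S : {set 'I_n.+1}) : coords S =
  (if ord0 \in S then [:: rV_cons (1, 0)] else [::]) ++
  [seq rV_cons (0, u) | u <- coords (tail_set S)].
Proof.
rewrite /coords /image_mem -map_comp /enum_mem -!enumT enum_ordSl /=.
rewrite filter_map.
rewrite (eq_filter (a2 := mem (tail_set S))); last by move=> i; rewrite !inE.
have E : [seq (delta_mx ord0 k : 'rV[R]_n.+1) | k <-
      [seq lift ord0 i | i <- enum 'I_n & mem (tail_set S) i]] =
    [seq rV_cons (0, delta_mx ord0 k) | k <- enum 'I_n & mem (tail_set S) k].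
  by rewrite -map_comp; apply: eq_map => k /=; rewrite delta_lift.
by case: ifP => h; rewrite /= E ?delta0.
Qed.

Lemma coord_proj_cons n (S : {set 'I_n.+1}) x (v : 'rV[R]_n) :
  coord_proj S (rV_cons (x, v)) =
  rV_cons (if ord0 \in S then x else 0, coord_proj (tail_set S) v).
Proof.
apply/rowP => i; rewrite rV_consE mxE rV_consE.
by case: unliftP => [j ->|->] //=; rewrite mxE inE.
Qed.

Lemma measurable_coord_proj n (S : {set 'I_n}) :
  measurable_fun [set: 'rV[R]_n] (coord_proj S).
Proof.
apply: measurable_fun_rV => i; under eq_fun do rewrite mxE.
by case: (i \in S); [exact: measurable_coord|exact: measurable_cst].
Qed.

Lemma uniform_cover_tail n m (S : 'I_m -> {set 'I_n.+1}) (p : 'I_m -> R) :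
  uniform_cover S p -> uniform_cover (fun j => tail_set (S j)) p.
Proof.
move=> [p0 pS]; split => // i; rewrite -[RHS](pS (lift ord0 i)).
by apply: eq_bigr => j _; rewrite inE.
Qed.

Local Open Scope ereal_scope.

(** In an induction on n, the first coordinate is integrated if it belongs to S
    and frozen at 0 otherwise. *)
Lemma span_int_coords_rec n (S : {set 'I_n.+1}) (f : 'rV[R]_n.+1 -> \bar R) :
  measurable_fun setT f -> (forall v, 0 <= f v) ->
  let g x := span_int (coords (tail_set S)) (fun v => f (rV_cons (x, v))) in
  span_int (coords S) f = if ord0 \in S then \int[mu]_x g x else g 0%R.
Proof.
move=> mf f0 /=; rewrite coords_rec; case: ifP => _; first exact: span_int_cons.
exact: span_int_map0.
Qed.

Lemma measurable_span_int_cons n (us : seq 'rV[R]_n) (f : 'rV[R]_n.+1 -> \bar R) :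
  measurable_fun setT f -> (forall v, 0 <= f v) ->
  measurable_fun [set: measurableTypeR R]
    (fun x => span_int us (fun v => f (rV_cons (x, v)))).
Proof.
move=> mf f0; apply: measurable_span_int => //.
apply: (measurableT_comp mf); apply: measurable_fun_cons.
  exact: measurable_fst.
exact: measurable_snd.
Qed.

Lemma span_int_ge0 n (us : seq 'rV[R]_n) (f : 'rV[R]_n -> \bar R) :
  (forall v, 0 <= f v) -> 0 <= span_int us f.
Proof. by move=> f0; exact: integral_ge0. Qed.

Lemma coords_nil0 (S : {set 'I_0}) : coords S = [::] :> seq 'rV[R]_0.
Proof.
by apply: size0nil; rewrite size_map -cardE; apply: eq_card0 => -[].
Qed.

Section cover.
Variables (m : nat) (p : 'I_m -> R).

Lemma big_cover_split n (S : 'I_m -> {set 'I_n.+1}) (F : 'I_m -> \bar R) :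
  \prod_j F j = \prod_(j | ord0 \notin S j) F j *
               \prod_(j <- [seq j <- index_enum 'I_m | ord0 \in S j]) F j.
Proof. by rewrite (bigID (fun j => ord0 \in S j)) /= muleC big_filter. Qed.

Lemma uniform_cover_head n (S : 'I_m -> {set 'I_n.+1}) : uniform_cover S p ->
  (\sum_(j <- [seq j <- index_enum 'I_m | ord0 \in S j]) p j = 1)%R.
Proof.
move=> [_ /(_ ord0) h]; rewrite -[RHS]h big_filter big_mkcond; apply: eq_bigr => j _.
by case: ifP; rewrite ?mulr1 ?mulr0.
Qed.

(** By induction on n. For a fixed first coordinate x the induction hypothesis
    bounds the integral over the others by a product of functions of x. Only the
    factors j such that S j contains the first coordinate depend on x; their
    weights sum to 1, so that the Hoelder inequality applies to them. *)
Theorem finner n (S : 'I_m -> {set 'I_n}) (h : 'I_m -> 'rV[R]_n -> \bar R) :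
  uniform_cover S p ->
  (forall j, measurable_fun setT (h j)) -> (forall j v, 0 <= h j v) ->
  \int[leb n]_v \prod_j h j (coord_proj (S j) v) `^ p j <=
  \prod_j span_int (coords (S j)) (h j) `^ p j.
Proof.
elim: n S h => [|n IH] S h cS mh h0.
  rewrite integral_leb0; apply: lee_prod => j _; rewrite poweR_ge0 /=.
  rewrite coords_nil0 span_int_nil (_ : coord_proj _ _ = 0%R)//.
  by apply/rowP => -[].
have [p0 _] := cS.
pose H j x := span_int (coords (tail_set (S j))) (fun v => h j (rV_cons (x, v))).
have mH j : measurable_fun [set: measurableTypeR R] (H j).
  exact: measurable_span_int_cons.
have H0 j x : 0 <= H j x by exact: span_int_ge0.
have cE j : span_int (coords (S j)) (h j) =
    if ord0 \in S j then \int[mu]_x H j x else H j 0%R.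
  exact: span_int_coords_rec.
have mprod : measurable_fun setT
    (fun v : 'rV[R]_n.+1 => \prod_j h j (coord_proj (S j) v) `^ p j).
  apply: emeasurable_prod => j; apply: measurable_fun_poweR.
  exact: (measurableT_comp (mh j) (measurable_coord_proj _)).
rewrite ge0_integral_leb_cons//; last first.
  by move=> v; apply: prode_ge0 => j _; exact: poweR_ge0.
set c := \prod_(j | ord0 \notin S j) H j 0%R `^ p j.
have c0 : 0 <= c by apply: prode_ge0 => j _; exact: poweR_ge0.
pose r := [seq j <- index_enum 'I_m | ord0 \in S j].
apply: (@le_trans _ _ (\int[mu]_x (c * \prod_(j <- r) H j x `^ p j))).
  apply: ge0_le_integral => //.
  - by move=> x _; apply: integral_ge0 => v _; apply: prode_ge0 => j _; exact: poweR_ge0.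
  - apply: measurable_fun_leb_integral => [|x v]; last first.
      by apply: prode_ge0 => j _; exact: poweR_ge0.
    apply: (measurableT_comp mprod); apply: measurable_fun_cons.
      exact: measurable_fst.
    exact: measurable_snd.
  - apply: measurable_funeM; apply: emeasurable_prod => j.
    exact: measurable_fun_poweR.
  - move=> x _.
    pose x_ j : R := if ord0 \in S j then x else 0%R.
    under eq_integral do under eq_bigr do rewrite coord_proj_cons.
    apply: (le_trans (IH (fun j => tail_set (S j))
      (fun j v => h j (rV_cons (x_ j, v))) (uniform_cover_tail cS) _ _)) => //.
      by move=> j; apply: (measurableT_comp (mh j)); exact: measurable_fun_cons.
    rewrite (big_cover_split S) big_filter /r big_filter.
    rewrite /c /x_; apply: lee_pmul.
    - by apply: prode_ge0 => j _; exact: poweR_ge0.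
    - by apply: prode_ge0 => j _; exact: poweR_ge0.
    - by apply: lee_prod => j /negbTE ->; rewrite poweR_ge0 lexx.
    - by apply: lee_prod => j ->; rewrite poweR_ge0 lexx.
rewrite ge0_integralZl//; last 2 first.
- by apply: emeasurable_prod => j; exact: measurable_fun_poweR.
- by move=> x _; apply: prode_ge0 => j _; exact: poweR_ge0.
rewrite (big_cover_split S) big_filter; apply: lee_pmul => //.
- by apply: integral_ge0 => x _; apply: prode_ge0 => j _; exact: poweR_ge0.
- by apply: lee_prod => j jS; rewrite poweR_ge0 cE (negbTE jS) lexx.
apply: (le_trans (hoelder_prod _ p0 (uniform_cover_head cS) mH H0)).
rewrite big_filter; apply: lee_prod => j jS; rewrite poweR_ge0 cE jS lexx//.
Qed.

(** The same induction with the Prekopa-Leindler inequality in place of the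
    Hoelder inequality: the points with first coordinate x are reached from first
    coordinates x_j with x = sum of p j x_j over the sets S j that contain it. *)
Theorem reverse_finner n (S : 'I_m -> {set 'I_n})
    (h : 'I_m -> 'rV[R]_n -> \bar R) (F : 'rV[R]_n -> \bar R) :
  uniform_cover S p ->
  (forall j, measurable_fun setT (h j)) -> (forall j v, 0 <= h j v) ->
  measurable_fun setT F -> (forall v, 0 <= F v) ->
  (forall t : 'I_m -> 'rV[R]_n, \prod_j h j (coord_proj (S j) (t j)) `^ p j
    <= F (\sum_j p j *: coord_proj (S j) (t j))%R) ->
  \prod_j span_int (coords (S j)) (h j) `^ p j <= \int[leb n]_v F v.
Proof.
elim: n S h F => [|n IH] S h F cS mh h0 mF F0 hF.
  rewrite integral_leb0; have := hF (fun=> 0%R).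
  rewrite (_ : (\sum_j _)%R = 0%R); last by apply/rowP => -[].
  apply: le_trans; apply: lee_prod => j _; rewrite poweR_ge0 /=.
  rewrite coords_nil0 span_int_nil (_ : coord_proj _ _ = 0%R)//.
  by apply/rowP => -[].
have [p0 _] := cS.
pose H j x := span_int (coords (tail_set (S j))) (fun v => h j (rV_cons (x, v))).
have H0 j x : 0 <= H j x by exact: span_int_ge0.
have cE j : span_int (coords (S j)) (h j) =
    if ord0 \in S j then \int[mu]_x H j x else H j 0%R.
  exact: span_int_coords_rec.
rewrite ge0_integral_leb_cons//.
pose r := [seq j <- index_enum 'I_m | ord0 \in S j].
set K := fun x => \int[leb n]_v F (rV_cons (x, v)).
have K0 x : 0 <= K x by exact: integral_ge0.
pose c := \prod_(j | ord0 \notin S j) H j 0%R `^ p j.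
have c0 : 0 <= c by apply: prode_ge0 => j _; exact: poweR_ge0.
have ur : uniq r by rewrite filter_uniq// index_enum_uniq.
have := @prekopa_leindler R 'I_m r p H K c ur p0 (uniform_cover_head cS) H0 c0 _ K0.
rewrite (big_cover_split S) /= => PL.
apply: le_trans (PL _ _).
- rewrite big_filter /r big_filter; apply: lee_pmul.
  + by apply: prode_ge0 => j _; exact: poweR_ge0.
  + by apply: prode_ge0 => j _; exact: poweR_ge0.
  + by apply: lee_prod => j jS; rewrite poweR_ge0 cE (negbTE jS) lexx.
  + by apply: lee_prod => j jS; rewrite poweR_ge0 cE jS lexx.
- apply: measurable_fun_leb_integral => //=.
  by apply: (measurableT_comp mF); exact: measurable_fun_cons.
move=> x.
(* The first coordinate of the point chosen in the j-th coordinate subspace. *)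
pose x_ j : R := if ord0 \in S j then x j else 0%R.
apply: (@le_trans _ _ (\prod_j span_int (coords (tail_set (S j)))
    (fun v => h j (rV_cons (x_ j, v))) `^ p j)).
  rewrite [leRHS](big_cover_split S) /r !big_filter; apply: lee_pmul.
  - by apply: prode_ge0 => j _; exact: poweR_ge0.
  - by apply: prode_ge0 => j _; exact: poweR_ge0.
  - by apply: lee_prod => j /negbTE jS; rewrite poweR_ge0 /x_ jS lexx.
  - by apply: lee_prod => j jS; rewrite poweR_ge0 /x_ jS lexx.
apply: IH => //.
- exact: uniform_cover_tail.
- by move=> j; apply: (measurableT_comp (mh j)); exact: measurable_fun_cons.
- by apply: (measurableT_comp mF); exact: measurable_fun_cons.
move=> t; have /= := hF (fun j => rV_cons (x j, t j)).
under eq_bigr do rewrite coord_proj_cons.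
move=> /le_trans; apply; rewrite le_eqVlt; apply/orP; left; apply/eqP; congr F.
apply/rowP => i; rewrite summxE rV_consE.
under [LHS]eq_bigr do rewrite mxE coord_proj_cons rV_consE.
case: unliftP => [k _|_] /=.
  by rewrite summxE; apply: eq_bigr => j _; rewrite [RHS]mxE.
rewrite /r big_filter [RHS]big_mkcond /=; apply: eq_bigr => j _.
by case: ifP; rewrite ?mulr0.
Qed.

End cover.

End coordinates.

(** * Borel envelopes of functions measurable for a completed measure *)

Section completion.
Context d (T : measurableType d) (R : realType).
Variable mu : {measure set T -> \bar R}.
Local Open Scope ereal_scope.

Local Notation cmu := (@completed_measure_extension d T R mu).
Local Notation cT := (caratheodory_type (mu^*)%mu).

Lemma measurable_completion (A : set T) : measurable A -> measurable (A : set cT).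
Proof. by move=> mA; apply: sub_caratheodory; exact: sub_sigma_algebra. Qed.

Lemma completionE (A : set T) : measurable A -> cmu A = mu A.
Proof. by move=> mA; rewrite /completed_measure_extension /= measurable_mu_extE. Qed.

(** The identity from the completed to the original sigma-algebra is measurable
    and pushes the completed measure forward to mu. *)
Lemma ge0_integral_completion (f : T -> \bar R) :
  measurable_fun setT f -> (forall x, 0 <= f x) ->
  \int[cmu]_x f x = \int[mu]_x f x.
Proof.
move=> mf f0.
have mid : measurable_fun [set: cT] (fun x : cT => x : T).
  by move=> _ Y mY; rewrite setTI; exact: measurable_completion.
pose pmu : {measure set T -> \bar R} :=
  measure_function_pushforward__canonical__measure_function_Measure cmu mid.
transitivity (\int[pmu]_x f x).
  by rewrite ge0_integral_pushforward.
by apply: eq_measure_integral => A mA _; exact: completionE.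
Qed.

(** Intersect a sequence of countable covers of almost minimal total measure. *)
Lemma outer_measure_hull (E : set T) : (mu^*)%mu E < +oo ->
  exists F : set T, [/\ measurable F, E `<=` F & mu F = (mu^*)%mu E].
Proof.
move=> Eoo.
have Efin : (mu^*)%mu E \is a fin_num by rewrite ge0_fin_numE// outer_measure_ge0.
have /choice[F HF] : forall n : nat, exists F : set T, [/\ measurable F, E `<=` F &
    mu F <= (mu^*)%mu E + (n.+1%:R^-1)%:E].
  move=> n; have n0 : (0 < n.+1%:R^-1 :> R)%R by rewrite invr_gt0.
  have [_ [A [mA EA] <-] hA] := lb_ereal_inf_adherent n0 Efin.
  exists (\bigcup_k A k); split => //; first exact: bigcupT_measurable.
  apply: le_trans (ltW hA).
  rewrite -measurable_mu_extE; last exact: bigcupT_measurable.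
  by apply: ereal_inf_lbound; exists A => //; split.
exists (\bigcap_n F n); split.
- by apply: bigcapT_measurable => n; have [] := HF n.
- by move=> x Ex n _; have [_ EF _] := HF n; exact: EF.
have mF : measurable (\bigcap_n F n) by apply: bigcapT_measurable => n; have [] := HF n.
apply/eqP; rewrite eq_le; apply/andP; split.
  apply/lee_addgt0Pr => e e0.
  near \oo => n.
  have [mFn _ hn] := HF n.
  apply: (@le_trans _ _ (mu (F n))).
    by apply: le_measure; rewrite ?inE//; exact: bigcap_inf.
  apply: (le_trans hn); rewrite leeD2l// lee_fin ltW//.
  by near: n; exact: near_infty_natSinv_lt (PosNum e0).
rewrite -measurable_mu_extE//; apply: le_outer_measure.
by move=> x Ex n _; have [_ EF _] := HF n; exact: EF.
Unshelve. all: by end_near. Qed.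

(** Remove from a hull F of E a hull N of the null set F minus E. *)
Lemma completion_kernel (E : set T) : measurable (E : set cT) -> cmu E < +oo ->
  exists B N : set T, [/\ measurable B, measurable N, B `<=` E, E `\` B `<=` N & mu N = 0].
Proof.
move=> mE Eoo.
have [F [mF EF muF]] := outer_measure_hull Eoo.
have mcF := measurable_completion mF.
have cFE : cmu F = cmu E by rewrite completionE.
have FE0 : cmu (F `\` E) = 0.
  have -> : cmu (F `\` E) = cmu F - cmu (F `&` E).
    by apply: measureD => //; rewrite -[X in X < _]/(cmu F) cFE.
  rewrite setIidr// cFE subee// ge0_fin_numE//.
have [|N [mN FEN muN]] := @outer_measure_hull (F `\` E).
  by rewrite [X in X < _]FE0.
exists (F `\` N), N; split => //.
- exact: measurableD.
- move=> x [Fx nNx]; apply: contrapT => nEx; apply: nNx; exact: FEN.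
- move=> x [Ex nx]; apply: contrapT => nNx; apply: nx; split => //; exact: EF.
- by rewrite muN [LHS]FE0.
Qed.

(** Immediate from the definition of the integral as a supremum over simple
    functions. It spares a proof that the composition of a function measurable for
    the completed measure of a subspace with the projection on this subspace is
    measurable. *)
Lemma ge0_le_integral_nonmeasurable d' (T' : measurableType d') 
    (m : {measure set T' -> \bar R}) (f g : T' -> \bar R) :
  (forall x, 0 <= f x) -> (forall x, f x <= g x) ->
  \int[m]_x f x <= \int[m]_x g x.
Proof.
move=> f0 fg; rewrite !ge0_integralTE//; last by move=> x; rewrite (le_trans (f0 x)).
by apply: ereal_sup_le => _ [h hf <-]; exists h => // x; rewrite (le_trans (hf x)).
Qed.

Lemma rat_between (y z : \bar R) : 0 <= y -> y < z ->
  exists q : rat, [/\ (0 < ratr q :> R)%R, y < (ratr q : R)%:E & (ratr q : R)%:E < z].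
Proof.
case: y => [r| |//]; last by move=> _; rewrite ltNge leey.
rewrite lee_fin => r0 rz.
have [s rs sz] : exists2 s : R, (r < s)%R & s%:E <= z.
  case: z rz => [s| |//]; first by rewrite lte_fin; exists s.
  by move=> _; exists (r + 1)%R; rewrite ?ltrDl ?leey.
have [q] := rat_in_itvoo rs; rewrite in_itv /= => /andP[rq qs].
exists q; split; rewrite ?lte_fin//; first exact: le_lt_trans rq.
by apply: lt_le_trans sz; rewrite lte_fin.
Qed.

(** The set {q < f} has finite measure for q > 0, hence contains a measurable set
    B q of the same measure; g is the supremum over the positive rationals q of q
    times the indicator of B q. *)
Lemma completion_minorant (f : T -> \bar R) :
  measurable_fun [set: cT] (f : cT -> \bar R) -> (forall x, 0 <= f x) ->
  \int[cmu]_x f x < +oo ->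
  exists (g : T -> \bar R) (N : set T), [/\ measurable_fun setT g,
    forall x, 0 <= g x <= f x, measurable N, mu N = 0 &
    forall x, ~ N x -> g x = f x].
Proof.
move=> mf f0 foo.
(* An enumeration of the nonnegative rationals. *)
pose q (k : nat) : R := if unpickle k is Some r then `|ratr (r : rat)|%R else 0%R.
have q0 k : (0 <= q k)%R by rewrite /q; case: unpickle.
have /choice[B /choice[N BN]] : forall k, exists B N : set T,
    [/\ measurable B, measurable N,
     B `<=` [set x | (0 < q k)%R /\ (q k)%:E < f x],
     [set x | (0 < q k)%R /\ (q k)%:E < f x] `\` B `<=` N & mu N = 0].
  move=> k; have [qk0|qk0] : (0 < q k \/ q k <= 0)%R by case: (ltP 0%R (q k)); [left|right].
    apply: completion_kernel.
      have := measurable_lte (@measurableT _ cT) (measurable_cst (q k)%:E) mf.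
      by congr (measurable _); apply/seteqP; split => x [].
    have h : (q k)%:E * cmu (setT `&` [set x | `|f x| >= (q k)%:E]) <= \int[cmu]_x f x.
      rewrite [leRHS](_ : _ = \int[cmu]_x `|f x|); first exact: le_integral_abse.
      by apply: eq_integral => x _; rewrite gee0_abs.
    rewrite -(@lte_pmul2l _ (q k)%:E)// gt0_muley//; apply: le_lt_trans foo.
    apply: le_trans h; rewrite lee_pmul2l//.
    apply: le_outer_measure => x [_ qf]; split => //=.
    by rewrite gee0_abs// ltW.
  exists set0, set0; split; rewrite ?measure0//.
  by move=> x [[]]; rewrite ltNge qk0.
pose h k x := (q k * \1_(B k) x)%:E.
exists (fun x => esups (h ^~ x) 0%N), (\bigcup_k N k).
have h0 k x : 0 <= h k x by rewrite lee_fin mulr_ge0.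
have hg k x : h k x <= esups (h ^~ x) 0%N.
  by apply: ereal_sup_ubound; exists k.
have g0 x : 0 <= esups (h ^~ x) 0%N by exact: le_trans (h0 0%N x) (hg 0%N x).
have gf x : esups (h ^~ x) 0%N <= f x.
  apply: ge_ereal_sup => _ [k _ <-]; rewrite /h indicE.
  have [xB|] := boolP (x \in B k); last by rewrite mulr0.
  have [_ _ BE _ _] := BN k; have [_ qf] := BE x (set_mem xB).
  by rewrite mulr1 ltW.
split.
- apply: measurable_fun_esups => k; apply/measurable_EFinP; apply: measurable_funM => //.
  by apply: measurable_indic; have [] := BN k.
- by move=> x; rewrite g0 gf.
- by apply: bigcupT_measurable => k; have [] := BN k.
- have mN k : measurable (N k) by have [] := BN k.
  apply/negligibleP; first exact: bigcupT_measurable.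
  apply: negligible_bigcup => k; apply/negligibleP => //.
  by have [] := BN k.
move=> x nN; apply/eqP; rewrite eq_le gf /= leNgt; apply/negP => gfx.
have [r [r0 gr rf]] := rat_between (g0 x) gfx.
have qr : q (pickle r) = ratr r by rewrite /q pickleK gtr0_norm.
have := hg (pickle r) x; rewrite /h qr indicE.
have [xB|xB] := boolP (x \in B (pickle r)); first by rewrite mulr1 leNgt gr.
exfalso; apply: nN; exists (pickle r) => //.
have [_ _ _ EB _] := BN (pickle r); apply: EB; split; first by rewrite /= qr.
by move=> /mem_set xB'; rewrite xB' in xB.
Qed.

(** The majorant takes the value +oo on the null set where the minorant may fail
    to agree with f. *)
Lemma completion_envelopes (f : T -> \bar R) :
  measurable_fun [set: cT] (f : cT -> \bar R) -> (forall x, 0 <= f x) ->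
  \int[cmu]_x f x < +oo ->
  (exists g : T -> \bar R, [/\ measurable_fun setT g, forall x, 0 <= g x <= f x &
     \int[mu]_x g x = \int[cmu]_x f x]) /\
  (exists g : T -> \bar R, [/\ measurable_fun setT g, forall x, f x <= g x &
     \int[mu]_x g x = \int[cmu]_x f x]).
Proof.
move=> mf f0 foo.
have [g [N [mg gf mN N0 gE]]] := completion_minorant mf f0 foo.
have g0 x : 0 <= g x by have /andP[] := gf x.
have intg : \int[mu]_x g x = \int[cmu]_x f x.
  rewrite -ge0_integral_completion//; apply: ge0_ae_eq_integral => //.
    move=> _ Y mY; rewrite setTI; apply: measurable_completion.
    by rewrite -[X in measurable X]setTI; exact: mg.
  exists N; split.
  - exact: measurable_completion.
  - by rewrite -[LHS]/(cmu N) completionE.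
  - by move=> x /= h; apply: contrapT => nN; apply: h => _; exact: gE.
split; first by exists g.
pose G x := if x \in N then +oo else g x.
have mG : measurable_fun setT G.
  apply: measurable_fun_if => //.
  - by apply: (measurable_fun_bool true); rewrite setTI preimage_mem_true.
  - exact: measurable_funTS.
exists G; split => //.
  move=> x; rewrite /G; case: (boolP (x \in N)) => [_|xN]; first by rewrite leey.
  by rewrite gE// => /mem_set xN'; rewrite xN' in xN.
rewrite -intg; apply: ge0_ae_eq_integral => //.
  by move=> x _; rewrite /G; case: ifP.
exists N; split => // x /= h; apply: contrapT => nN; apply: h => _.
by rewrite /G memNset.
Qed.

End completion.

(** * Lebesgue measure of a subspace and Gram determinants *)

Section gram.
Context {R : realType}.
Local Notation leb := (@borel_lebesgue R).

Lemma dotv_mulmx n (u v : 'rV[R]_n) : dotv u v = (u *m v^T) ord0 ord0.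
Proof. by rewrite mxE; apply: eq_bigr => i _; rewrite mxE. Qed.

(** If v U U^T = 0 then the vector v U has norm 0. *)
Lemma gram_det_neq0 d n (U : 'M[R]_(d, n)) :
  (forall v : 'rV_d, v *m U = 0 -> v = 0) -> \det (U *m U^T) != 0.
Proof.
move=> Ufree; apply/negP => /det0P[v v0 vUU].
have : dotv (v *m U) (v *m U) = 0.
  by rewrite dotv_mulmx trmx_mul mulmxA -[v *m U *m U^T]mulmxA vUU mul0mx mxE.
have [/Ufree v00|vU0] := eqVneq (v *m U) 0; first by rewrite v00 eqxx in v0.
by move=> h; have := dotvv_gt0 vU0; rewrite h ltxx.
Qed.

Lemma free_rows_mx n (us : seq 'rV[R]_n) : free us ->
  forall v : 'rV_(size us), v *m rows_mx us = 0 -> v = 0.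
Proof.
move=> /(@freeP _ _ _ (in_tuple us)) us_free v vU; apply/rowP => i; rewrite mxE.
apply: (us_free (fun i => v ord0 i)); rewrite -[RHS]vU mulmx_sum_row.
by apply: eq_bigr => k _; rewrite row_rows_mx.
Qed.

Lemma det_gram_orthonormal d n (A : 'M[R]_d) (Q : 'M[R]_(d, n)) : Q *m Q^T = 1%:M ->
  \det ((A *m Q) *m (A *m Q)^T) = \det A ^+ 2.
Proof.
by move=> QQ; rewrite trmx_mul -mulmxA [Q *m _]mulmxA QQ mul1mx det_mulmx det_tr.
Qed.

Definition onb_mx n (F : {vspace 'rV[R]_n}) : 'M[R]_(\dim F, n) :=
  \matrix_i tnth (onb F) i.

Lemma onb_mapE n (F : {vspace 'rV[R]_n}) t : onb_map t = t *m onb_mx F.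
Proof. by rewrite mulmx_sum_row; apply: eq_bigr => i _; rewrite rowK. Qed.

Lemma onb_mx_orthonormal n (F : {vspace 'rV[R]_n}) : onb_mx F *m (onb_mx F)^T = 1%:M.
Proof.
have [_ ob] := onbP F; apply/matrixP => i j.
rewrite [RHS]mxE -ob /dotv mxE; apply: eq_bigr => k _.
by rewrite mxE [_^T k j]mxE mxE.
Qed.

Lemma onb_mx_span n (F : {vspace 'rV[R]_n}) d (U : 'M[R]_(d, n)) :
  (forall i, row i U \in F) -> exists A, U = A *m onb_mx F.
Proof.
move=> UF; have [bF _] := onbP F.
exists (\matrix_(i, k) coord (onb F) k (row i U)).
apply/row_matrixP => i; rewrite row_mul mulmx_sum_row.
rewrite [LHS](coord_basis bF (UF i)); apply: eq_bigr => k _.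
by rewrite rowK 2!mxE (tnth_nth 0).
Qed.

Local Open Scope ereal_scope.

(** The measure of F is defined through an orthonormal basis, the rows of a matrix
    Q. As U = A Q for an
    invertible A, the Jacobian |det A| is the square root of det (U U^T), a formula
    that does not mention Q. *)
Lemma ge0_integral_sub_mx n (F : {vspace 'rV[R]_n}) d (U : 'M[R]_(d, n))
    (g : 'rV[R]_n -> \bar R) : d = \dim F -> (forall i, row i U \in F) ->
  \det (U *m U^T)%R != 0%R -> measurable_fun setT g -> (forall x, 0 <= g x) ->
  \int[borel_lebesgue_sub F]_x g x =
  (Num.sqrt (\det (U *m U^T)%R))%:E * \int[leb d]_t g (t *m U).
Proof.
move=> dF; subst d => UF detU mg g0.
rewrite ge0_integral_pushforward//; last exact: measurable_onb_map.
have [A UA] := onb_mx_span UF.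
have detE : (\det (U *m U^T) = \det A ^+ 2)%R.
  by rewrite UA det_gram_orthonormal//; exact: onb_mx_orthonormal.
have detA : \det A != 0%R by move: detU; rewrite detE expf_eq0.
rewrite detE sqrtr_sqr.
rewrite (eq_integral (fun t => g (t *m onb_mx F))); last first.
  by move=> t _ /=; rewrite onb_mapE.
rewrite (@ge0_integral_mulmx _ _ A detA (fun t => g (t *m onb_mx F)))//; last first.
  exact: (measurableT_comp mg (measurable_mulmx _)).
by congr (_ * _); apply: eq_integral => t _; rewrite UA mulmxA.
Qed.

(** U has a right inverse L, hence the image of the cube consists of the vectors v
    with v L U = v whose image v L is in the cube. *)
Lemma measurable_image_cube n d (U : 'M[R]_(d, n)) :
  (forall v : 'rV_d, v *m U = 0 -> v = 0)%R ->
  measurable [set t *m U | t in [set t : 'rV[R]_d | forall i, (0 <= t ord0 i <= 1)%R]]%R.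
Proof.
move=> Ufree; have detU := gram_det_neq0 Ufree.
pose L := (U^T *m invmx (U *m U^T))%R.
have UL : (U *m L = 1%:M)%R by rewrite mulmxA mulmxV// unitmxE unitfE.
rewrite (_ : [set _ | _ in _] =
    \bigcap_(i in [set: 'I_n]) ((fun v => (v *m (L *m U)%R - v) ord0 i)%R @^-1` [set 0%R]) `&`
    \bigcap_(i in [set: 'I_d]) ((fun v => (v *m L) ord0 i)%R @^-1` `[0%R, 1%R])).
  apply: measurableI.
    apply: fin_bigcap_measurable => // i _.
    rewrite -[X in measurable X]setTI.
    have : measurable_fun [set: 'rV[R]_n]
        (fun v => (v *m (L *m U) - v) ord0 i : measurableTypeR R)%R.
      under eq_fun do rewrite mxE [X in (_ + X)%R]mxE.
      apply: measurable_funB; last exact: measurable_coord.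
      exact: (measurableT_comp (measurable_coord i) (measurable_mulmx _)).
    by apply; [exact: measurableT|exact: measurable_set1].
  apply: fin_bigcap_measurable => // i _.
  rewrite -[X in measurable X]setTI.
  have : measurable_fun [set: 'rV[R]_n] (fun v => (v *m L) ord0 i : measurableTypeR R)%R.
    exact: (measurableT_comp (measurable_coord i) (measurable_mulmx _)).
  by apply; [exact: measurableT|exact: measurable_itv].
apply/seteqP; split => v /=.
  move=> [t t01 <-]; split => i _ /=.
    by rewrite -mulmxA [(U *m _)%R]mulmxA UL mul1mx subrr mxE.
  by rewrite -mulmxA UL mulmx1 in_itv /= t01.
move=> [h1 h2]; exists (v *m L)%R.
  by move=> i; have := h2 i I; rewrite /= in_itv.
by rewrite -mulmxA; apply/eqP; rewrite -subr_eq0; apply/eqP/rowP => i; rewrite (h1 i I) mxE.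
Qed.

Lemma measurable_unit_cube d :
  measurable [set t : 'rV[R]_d | forall i, (0 <= t ord0 i <= 1)%R].
Proof.
rewrite (_ : [set _ | _] = [set (t *m 1%:M)%R | t in
    [set t : 'rV[R]_d | forall i, (0 <= t ord0 i <= 1)%R]]).
  by apply: measurable_image_cube => v; rewrite mulmx1.
by apply/seteqP; split => t /=; [exists t; rewrite ?mulmx1|move=> [s s01 <-]; rewrite mulmx1].
Qed.

Lemma leb_unit_cube d :
  leb d [set t : 'rV[R]_d | forall i, (0 <= t ord0 i <= 1)%R] = 1.
Proof.
rewrite (borel_lebesgue_box (A := fun=> `[0%R, 1%R]%classic))//.
by rewrite big1// => i _; rewrite lebesgue_measure_itv /= lte01 oppr0 adde0.
Qed.

Lemma wedge_normE n (us : seq 'rV[R]_n) : free us ->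
  wedge_norm us = (Num.sqrt (\det (rows_mx us *m (rows_mx us)^T)))%R.
Proof.
move=> us_free; rewrite /wedge_norm us_free.
pose U := rows_mx us.
have Uinj := free_rows_mx us_free.
have detU := gram_det_neq0 Uinj.
have PE : parallelepiped us = [set (t *m U)%R | t in
    [set t : 'rV[R]_(size us) | forall i, (0 <= t ord0 i <= 1)%R]].
  apply/seteqP; split => _ [t t01 <-] /=.
    exists (\row_i t i)%R; first by move=> i; rewrite mxE.
    by rewrite mulmx_sum_row; apply: eq_bigr => i _; rewrite mxE row_rows_mx.
  exists (fun i => t ord0 i) => //.
  by rewrite mulmx_sum_row; apply: eq_bigr => i _; rewrite row_rows_mx.
have mP : measurable (parallelepiped us) by rewrite PE; exact: measurable_image_cube.
rewrite [lebesgue_sub _ _](completionE (borel_lebesgue_sub <<us>>%VS) mP).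
rewrite -(setIT (parallelepiped us)) -integral_indic//.
rewrite (@ge0_integral_sub_mx _ _ (size us) U)//.
- rewrite (eq_integral (fun t => (\1_[set t : 'rV[R]_(size us) |
      forall i, (0 <= t ord0 i <= 1)%R] t)%:E)); last first.
    move=> t _; rewrite !indicE; congr ((nat_of_bool _)%:R%:E).
    apply/idP/idP; rewrite !inE PE /=; last by exists t.
    move=> [s s01 /eqP]; rewrite -subr_eq0 -mulmxBl => /eqP /Uinj /eqP.
    by rewrite subr_eq0 => /eqP <-.
  rewrite integral_indic//; last exact: measurable_unit_cube.
  by rewrite setIT [X in _ * X](@leb_unit_cube (size us)) mule1.
- by move: us_free => /eqP ->.
- by move=> i; rewrite row_rows_mx memv_span// mem_nth.
- apply/measurable_EFinP; exact: measurable_indic.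
Qed.

Lemma orthoprojE n (F : {vspace 'rV[R]_n}) d (U : 'M[R]_(d, n)) x :
  d = \dim F -> (forall i, row i U \in F) -> \det (U *m U^T)%R != 0%R ->
  orthoproj F x = (x *m U^T *m invmx (U *m U^T) *m U)%R.
Proof.
move=> dF UF detU.
have UU : (U *m U^T \in unitmx)%R by rewrite unitmxE unitfE.
have memF (c : 'rV[R]_d) : (c *m U)%R \in F.
  by rewrite mulmx_sum_row; apply: memv_suml => i _; exact: memvZ.
have [A UA] : exists A, U = (A *m onb_mx F)%R by exact: onb_mx_span.
(* The rows of U form a basis of F, since there are \dim F of them. *)
have Fspan z : z \in F -> exists c, z = (c *m U)%R.
  move=> zF; have [B zB] : exists B, z = (B *m onb_mx F)%R.
    by apply: onb_mx_span => i; rewrite ord1 row_id.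
  subst d; exists (B *m invmx A)%R.
  have Au : A \in unitmx.
    rewrite unitmxE unitfE; move: detU; rewrite UA det_gram_orthonormal ?expf_eq0//.
    exact: onb_mx_orthonormal.
  by rewrite UA -mulmxA [(invmx A *m _)%R]mulmxA mulVmx// mul1mx.
set y := (_ *m U)%R.
have [PF Pperp] := orthoprojP F x.
have yF : y \in F by exact: memF.
have yperp z : z \in F -> dotv (x - y) z = 0%R.
  move=> /Fspan[c ->]; rewrite dotv_mulmx trmx_mul mulmxA mulmxBl.
  rewrite (_ : (y *m U^T = x *m U^T)%R) ?subrr ?mul0mx ?mxE//.
  by rewrite /y -!mulmxA mulVmx// mulmx1.
apply/eqP; rewrite -subr_eq0; apply/negPn/negP => /dotvv_gt0.
set z := (_ - y)%R.
have zF : z \in F by rewrite rpredB.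
rewrite (_ : dotv z z = dotv (x - y) z - dotv (x - orthoproj F x) z)%R.
  by rewrite yperp// Pperp// subrr ltxx.
by rewrite -dotvBl; congr dotv; apply/esym; rewrite opprB addrC addrA subrK.
Qed.

End gram.

(** * From the subspaces spanned by a basis to the coordinate subspaces *)

Section subspace_envelopes.
Context {R : realType} (n : nat).
Implicit Type F : {vspace 'rV[R]_n}.

Lemma measurable_subspace F : measurable [set x : 'rV[R]_n | x \in F].
Proof.
pose P := (onb_mx F)^T *m onb_mx F.
have OF i : row i (onb_mx F) \in F.
  by have [bF _] := onbP F; rewrite rowK (basis_mem bF)// mem_tnth.
rewrite (_ : [set _ | _] =
    \bigcap_(i in [set: 'I_n]) ((fun v => (v *m P - v) ord0 i) @^-1` [set 0])).
  apply: fin_bigcap_measurable => // i _.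
  rewrite -[X in measurable X]setTI.
  have : measurable_fun [set: 'rV[R]_n] (fun v => (v *m P - v) ord0 i : measurableTypeR R).
    under eq_fun do rewrite mxE [X in _ + X]mxE.
    apply: measurable_funB; last exact: measurable_coord.
    exact: (measurableT_comp (measurable_coord i) (measurable_mulmx _)).
  by apply; [exact: measurableT|exact: measurable_set1].
apply/seteqP; split => x /=.
  move=> xF i _ /=; have [c ->] : exists c, x = c *m onb_mx F.
    by apply: onb_mx_span => k; rewrite ord1 row_id.
  by rewrite -mulmxA [onb_mx F *m _]mulmxA onb_mx_orthonormal mul1mx subrr mxE.
move=> h; have -> : x = x *m (onb_mx F)^T *m onb_mx F.
  by apply/esym/eqP; rewrite -subr_eq0 -mulmxA; apply/eqP/rowP => i; rewrite (h i I) mxE.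
by rewrite mulmx_sum_row; apply: memv_suml => i _; exact: memvZ.
Qed.

Local Open Scope ereal_scope.

Lemma lebesgue_sub_envelopes F (f : 'rV[R]_n -> R) :
  (forall x, x \in F -> 0 <= f x)%R ->
  (lebesgue_sub F).-integrable [set x | x \in F] (fun x => (f x)%:E) ->
  (exists g : 'rV[R]_n -> \bar R, [/\ measurable_fun setT g, forall x, 0 <= g x,
     forall x, x \in F -> g x <= (f x)%:E &
     \int[borel_lebesgue_sub F]_x g x =
     \int[lebesgue_sub F]_(x in [set x | x \in F]) (f x)%:E]) /\
  (exists g : 'rV[R]_n -> \bar R, [/\ measurable_fun setT g, forall x, 0 <= g x,
     forall x, x \in F -> (f x)%:E <= g x &
     \int[borel_lebesgue_sub F]_x g x =
     \int[lebesgue_sub F]_(x in [set x | x \in F]) (f x)%:E]).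
Proof.
move=> f0 fint.
pose D := [set x : 'rV[R]_n | x \in F].
pose phi := (fun x => (f x)%:E) \_ D.
have phi0 x : 0 <= phi x.
  by rewrite /phi patchE; case: ifPn => // /set_mem xF; rewrite lee_fin f0.
have phiE x : x \in F -> phi x = (f x)%:E.
  by move=> xF; rewrite /phi patchE mem_set.
have intE : \int[lebesgue_sub F]_(x in D) (f x)%:E = \int[lebesgue_sub F]_x phi x.
  by rewrite integral_mkcond.
have mD := measurable_completion (borel_lebesgue_sub F) (measurable_subspace F).
have [mf _] := integrableP _ _ _ fint.
have mphi : measurable_fun [set: caratheodory_type ((borel_lebesgue_sub F)^*)%mu]
    (phi : caratheodory_type ((borel_lebesgue_sub F)^*)%mu -> \bar R).
  exact: (iffLR (measurable_restrictT _ mD) mf).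
have phioo : \int[lebesgue_sub F]_x phi x < +oo.
  by rewrite -intE; exact: integrable_lty.
have [[g [mg gphi intg]] [h [mh hphi inth]]] := completion_envelopes mphi phi0 phioo.
split.
  exists g; split => //.
  - by move=> x; have /andP[] := gphi x.
  - by move=> x xF; have /andP[_] := gphi x; rewrite phiE.
  - by rewrite intE.
exists h; split => //.
- by move=> x; rewrite (le_trans (phi0 x)).
- by move=> x xF; rewrite -phiE.
- by rewrite intE.
Qed.

End subspace_envelopes.

Section family.
Context {R : realType} (n : nat) (w : 'I_n -> 'rV[R]_n).
Hypothesis basis_w : basis_of fullv [seq w i | i : 'I_n].
Local Notation leb := (@borel_lebesgue R).

Implicit Type S : {set 'I_n}.

Let W : 'M[R]_n := \matrix_i w i.

Lemma row_injective (us : seq 'rV[R]_n) d (U : 'M[R]_(d, n)) : free us ->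
  d = size us -> (forall i, row i U = us`_i) ->
  forall v : 'rV_d, v *m U = 0 -> v = 0.
Proof.
move=> us_free ds; subst d => rU.
have -> : U = rows_mx us by apply/row_matrixP => i; rewrite rU row_rows_mx.
exact: free_rows_mx.
Qed.

Lemma row_wedge_norm (us : seq 'rV[R]_n) d (U : 'M[R]_(d, n)) : free us ->
  d = size us -> (forall i, row i U = us`_i) ->
  wedge_norm us = Num.sqrt (\det (U *m U^T)).
Proof.
move=> us_free ds; subst d => rU.
have -> : U = rows_mx us by apply/row_matrixP => i; rewrite rU row_rows_mx.
exact: wedge_normE.
Qed.

Lemma free_rows (us : seq 'rV[R]_n) d (U : 'M[R]_(d, n)) :
  d = size us -> (forall i, row i U = us`_i) ->
  (forall v : 'rV_d, v *m U = 0 -> v = 0) -> free us.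
Proof.
move=> ds; subst d => rU Uinj; apply/(@freeP _ _ _ (in_tuple us)) => k k0 i.
have : \row_i k i *m U = 0.
  by rewrite mulmx_sum_row -[RHS]k0; apply: eq_bigr => j _; rewrite mxE rU.
by move=> /Uinj /rowP /(_ i); rewrite !mxE.
Qed.

Lemma row_family_mx i : row i W = [seq w i | i : 'I_n]`_i.
Proof. by rewrite rowK (nth_map i) ?size_enum_ord// nth_ord_enum. Qed.

Lemma size_family : n = size [seq w i | i : 'I_n].
Proof. by rewrite size_image card_ord. Qed.

Lemma family_mx_inj (v : 'rV_n) : v *m W = 0 -> v = 0.
Proof. exact: (row_injective (basis_free basis_w) size_family row_family_mx). Qed.

Lemma det_family_neq0 : \det W != 0.
Proof.
by have := gram_det_neq0 family_mx_inj; rewrite det_mulmx det_tr mulf_eq0 orbb.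
Qed.

Lemma wedge_norm_basis : wedge_norm [seq w i | i : 'I_n] = `|\det W|.
Proof.
rewrite (row_wedge_norm (basis_free basis_w) size_family row_family_mx).
by rewrite det_mulmx det_tr -expr2 sqrtr_sqr.
Qed.

Definition coord_mx (S : {set 'I_n}) : 'M[R]_(#|S|, n) :=
  \matrix_i delta_mx ord0 (enum_val i).

Lemma coord_mx_orthonormal (S : {set 'I_n}) : coord_mx S *m (coord_mx S)^T = 1%:M.
Proof.
apply/matrixP => i k; rewrite !mxE (bigD1 (enum_val i))//= big1 => [|l li].
  by rewrite !mxE !eqxx mul1r addr0 (inj_eq enum_val_inj).
by rewrite !mxE (negbTE li) andbF mul0r.
Qed.

Lemma coord_proj_mx (S : {set 'I_n}) v :
  coord_proj S v *m (coord_mx S)^T = v *m (coord_mx S)^T :> 'rV[R]_#|S|.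
Proof.
apply/rowP => i; rewrite !mxE; apply: eq_bigr => l _; rewrite !mxE /=.
case: ifPn => // lS; case: eqP => [E|]; last by rewrite !mulr0.
by rewrite E enum_valP in lS.
Qed.

Lemma span_int_coords (S : {set 'I_n}) (f : 'rV[R]_n -> \bar R) :
  span_int (coords S) f = (\int[leb #|S|]_t f (t *m coord_mx S))%E.
Proof.
apply: span_intE; first by rewrite size_image.
by move=> i; rewrite rowK nth_image.
Qed.

Definition sub_mx S : 'M[R]_(#|S|, n) := coord_mx S *m W.

Let us (S : {set 'I_n}) := [seq w k | k in S].

Lemma row_sub_mx S i : row i (sub_mx S) = (us S)`_i.
Proof. by rewrite row_mul rowK -rowE rowK nth_image. Qed.

Lemma sub_mx_inj S (v : 'rV_#|S|) : v *m sub_mx S = 0 -> v = 0.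
Proof.
rewrite mulmxA => /family_mx_inj vC.
by rewrite -[v]mulmx1 -(coord_mx_orthonormal S) mulmxA vC mul0mx.
Qed.

Lemma free_sub S : free (us S).
Proof.
apply: (free_rows _ (row_sub_mx (S := S)) (@sub_mx_inj S)).
by rewrite size_image.
Qed.

Lemma wedge_norm_sub S : wedge_norm (us S) = Num.sqrt (\det (sub_mx S *m (sub_mx S)^T)).
Proof.
apply: (row_wedge_norm (free_sub S) _ (@row_sub_mx S)); by rewrite size_image.
Qed.

Lemma gram_sub_neq0 S : \det (sub_mx S *m (sub_mx S)^T) != 0.
Proof. exact: (gram_det_neq0 (@sub_mx_inj S)). Qed.

Lemma dim_span_sub S : #|S| = \dim <<us S>>%VS.
Proof. by have /eqP -> := free_sub S; rewrite size_image. Qed.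

Lemma row_sub_span S i : row i (sub_mx S) \in <<us S>>%VS.
Proof. by rewrite row_sub_mx memv_span// mem_nth// size_image. Qed.

Lemma det_gram_gt0 (F : {vspace 'rV[R]_n}) d (U : 'M[R]_(d, n)) :
  d = \dim F -> (forall i, row i U \in F) -> \det (U *m U^T) != 0 ->
  0 < \det (U *m U^T).
Proof.
move=> dF; subst d => /onb_mx_span[A ->].
rewrite det_gram_orthonormal; last exact: onb_mx_orthonormal.
by rewrite expf_eq0 /= => ?; rewrite exprn_even_gt0.
Qed.

Lemma wedge_norm_sub_gt0 S : 0 < wedge_norm (us S).
Proof.
rewrite wedge_norm_sub sqrtr_gt0.
exact: (det_gram_gt0 (dim_span_sub S) (row_sub_span (S := S)) (gram_sub_neq0 S)).
Qed.

Local Open Scope ereal_scope.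

Lemma span_int_sub S (g : 'rV[R]_n -> \bar R) :
  measurable_fun setT g -> (forall x, 0 <= g x) ->
  \int[borel_lebesgue_sub <<us S>>%VS]_x g x =
  (wedge_norm (us S))%:E * span_int (coords S) (fun v => g (v *m W)).
Proof.
move=> mg g0.
rewrite (ge0_integral_sub_mx (dim_span_sub S) (@row_sub_span S) (gram_sub_neq0 S))//.
rewrite -wedge_norm_sub span_int_coords; congr (_ * _).
by apply: eq_integral => t _; rewrite mulmxA.
Qed.

(** The basis of the span of the w_k, k in S, that is dual to (w_k). *)
Definition dual_mx S : 'M[R]_(#|S|, n) :=
  (invmx (sub_mx S *m (sub_mx S)^T) *m sub_mx S)%R.

(** The scalar products with the w_k, k in S, which are the coordinates in S of
    x W^T, determine the projection of x. *)
Lemma orthoproj_sub S x :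
  orthoproj <<us S>>%VS x = (coord_proj S (x *m W^T) *m (coord_mx S)^T *m dual_mx S)%R.
Proof.
rewrite (orthoprojE x (dim_span_sub S) (@row_sub_span S) (gram_sub_neq0 S)).
by rewrite coord_proj_mx /dual_mx [in LHS]/sub_mx trmx_mul !mulmxA.
Qed.

(** The Gram matrix of the dual basis is the inverse of that of the basis. *)
Lemma span_int_dual S (g : 'rV[R]_n -> \bar R) :
  measurable_fun setT g -> (forall x, 0 <= g x) ->
  span_int (coords S) (fun v => g (v *m (coord_mx S)^T *m dual_mx S)%R) =
  (wedge_norm (us S))%:E * \int[borel_lebesgue_sub <<us S>>%VS]_x g x.
Proof.
move=> mg g0.
set G := (sub_mx S *m (sub_mx S)^T)%R.
have Gu : G \in unitmx by rewrite unitmxE unitfE gram_sub_neq0.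
have GT : (G^T = G)%R by rewrite [LHS]trmx_mul trmxK.
have PT : ((dual_mx S)^T = (sub_mx S)^T *m invmx G)%R.
  by rewrite [LHS]trmx_mul trmx_inv GT.
have PP : (dual_mx S *m (dual_mx S)^T = invmx G)%R.
  by rewrite PT mulmxA /dual_mx -[(invmx _ *m _ *m _^T)%R]mulmxA mulVmx// mul1mx.
have detP : \det (dual_mx S *m (dual_mx S)^T)%R != 0%R.
  by rewrite PP det_inv invr_neq0// gram_sub_neq0.
have Prow i : row i (dual_mx S) \in <<us S>>%VS.
  rewrite row_mul mulmx_sum_row; apply: memv_suml => k _; apply: memvZ.
  exact: row_sub_span.
rewrite (ge0_integral_sub_mx (dim_span_sub S) Prow detP)//.
have gram0 := wedge_norm_sub_gt0 S.
rewrite PP det_inv sqrtrV; last first.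
  by rewrite ltW// (det_gram_gt0 (dim_span_sub S) (@row_sub_span S) (gram_sub_neq0 S)).
rewrite -wedge_norm_sub muleA -EFinM divff ?mul1e ?gt_eqF//.
rewrite span_int_coords; apply: eq_integral => t _.
by rewrite -[(t *m _ *m _)%R]mulmxA coord_mx_orthonormal mulmx1.
Qed.

End family.

Section main.
Context {R : realType} (n m : nat) (w : 'I_n -> 'rV[R]_n).
Variables (S : 'I_m -> {set 'I_n}) (p : 'I_m -> R).
Hypothesis basis_w : basis_of fullv [seq w i | i : 'I_n].
Hypothesis cover_S : uniform_cover S p.
Local Open Scope ereal_scope.
Let H := fun j : 'I_m => <<[seq w k | k in S j]>>%VS.
Let W : 'M[R]_n := (\matrix_i w i)%R.

Lemma prod_wedge_poweR (a : 'I_m -> \bar R) : (forall j, 0 <= a j) ->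
  \prod_j ((wedge_norm [seq w k | k in S j])%:E * a j) `^ p j =
  (\prod_j wedge_norm [seq w k | k in S j] `^ p j)%:E * \prod_j a j `^ p j.
Proof.
move=> a0; rewrite -prodEFin -big_split; apply: eq_bigr => j _ /=.
by rewrite poweRM// lee_fin ltW// wedge_norm_sub_gt0.
Qed.

Lemma measurable_prod_poweR d (T : measurableType d) (f : 'I_m -> T -> \bar R) :
  (forall j, measurable_fun setT (f j)) ->
  measurable_fun setT (fun x => \prod_j f j x `^ p j).
Proof.
by move=> mf; apply: emeasurable_prod => j; exact: measurable_fun_poweR.
Qed.

Lemma prod_poweR_ge0 (a : 'I_m -> \bar R) : 0 <= \prod_j a j `^ p j.
Proof. by apply: prode_ge0 => j _; exact: poweR_ge0. Qed.

(** In the variable y = x W^T the projection on H j depends only on the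
    coordinates of y in S j, so that the coordinate inequality applies to Borel
    majorants g j of the functions, written in the dual bases. *)
Theorem brascamp_lieb_subspaces (f_ : 'I_m -> 'rV[R]_n -> R) :
  (forall j x, x \in H j -> 0 <= f_ j x)%R ->
  (forall j, (lebesgue_sub (H j)).-integrable [set x | x \in H j]
               (fun x => (f_ j x)%:E)) ->
  \int[lebesgue_rV n]_x (\prod_(j < m) f_ j (orthoproj (H j) x) `^ p j)%:E
   <= (BL2 w S p)%:E *
      \prod_(j < m)
        (\int[lebesgue_sub (H j)]_(x in [set x | x \in H j]) (f_ j x)%:E)
          `^ p j.
Proof.
move=> f0 fint; have [p0 _] := cover_S.
have /choice[g Hg] : forall j, exists g : 'rV[R]_n -> \bar R,
    [/\ measurable_fun setT g, forall x, 0 <= g x,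
     forall x, x \in H j -> (f_ j x)%:E <= g x &
     \int[borel_lebesgue_sub (H j)]_x g x =
     \int[lebesgue_sub (H j)]_(x in [set x | x \in H j]) (f_ j x)%:E].
  by move=> j; exact: (lebesgue_sub_envelopes (f0 j) (fint j)).2.
have mg j : measurable_fun setT (g j) by have [] := Hg j.
have g0 j x : 0 <= g j x by have [] := Hg j.
pose h j v := g j (v *m (coord_mx (S j))^T *m dual_mx w (S j))%R.
have mh j : measurable_fun setT (h j).
  apply: (measurableT_comp (mg j)).
  by apply: (measurableT_comp (measurable_mulmx _)); exact: measurable_mulmx.
have h0 j v : 0 <= h j v by exact: g0.
pose Psi y := \prod_j h j (coord_proj (S j) y) `^ p j.
have mPsi : measurable_fun setT Psi.
  apply: measurable_prod_poweR => j.
  exact: (measurableT_comp (mh j) (measurable_coord_proj _)).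
have Psi0 y : 0 <= Psi y by exact: prod_poweR_ge0.
have mPsiW : measurable_fun setT (fun x => Psi (x *m W^T)).
  exact: (measurableT_comp mPsi (measurable_mulmx _)).
apply: (@le_trans _ _ (\int[lebesgue_rV n]_x Psi (x *m W^T))).
  apply: ge0_le_integral_nonmeasurable => x.
    by rewrite lee_fin; apply: prodr_ge0 => j _; exact: powR_ge0.
  rewrite -prodEFin; apply: lee_prod => j _; rewrite -poweR_EFin poweR_ge0 andTb.
  have PH : orthoproj (H j) x \in H j by have [] := orthoprojP (H j) x.
  rewrite gt0_ler_poweR ?(ltW (p0 j))//.
  - by rewrite in_itv /= lee_fin f0// leey.
  - by rewrite in_itv /= h0 leey.
  - have [_ _ fg _] := Hg j.
    by rewrite /h -(orthoproj_sub basis_w); exact: fg.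
rewrite [leLHS](ge0_integral_completion (borel_lebesgue n) mPsiW)//.
have detW := det_family_neq0 basis_w.
have detWT : \det W^T != 0%R by rewrite det_tr.
have absW : (0 < `|\det W|)%R by rewrite normr_gt0.
have := ge0_integral_mulmx detWT mPsi Psi0; rewrite det_tr => intPsi.
rewrite -(@lee_pmul2l _ `|\det W|%:E)// -intPsi.
apply: (le_trans (finner cover_S mh h0)).
rewrite (eq_bigr (fun j => ((wedge_norm [seq w k | k in S j])%:E *
    \int[borel_lebesgue_sub (H j)]_x g j x) `^ p j)) => [|j _]; last first.
  by rewrite (span_int_dual basis_w).
rewrite prod_wedge_poweR; last by move=> j; exact: integral_ge0.
rewrite muleA -EFinM (_ : (`|\det W| * BL2 w S p)%R =
    (\prod_j wedge_norm [seq w k | k in S j] `^ p j)%R); last first.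
  by rewrite /BL2 (wedge_norm_basis basis_w) mulrC divfK// gt_eqF.
rewrite le_eqVlt; apply/predU1P; left; congr (_ * _).
by apply: eq_bigr => j _; have [_ _ _ ->] := Hg j.
Qed.

(** In the coordinates given by the basis w the subspaces H j are the coordinate
    subspaces of the S j, so that the reverse coordinate inequality applies to
    Borel minorants g j of the f_ j and a Borel majorant F of f. *)
Theorem reverse_brascamp_lieb_subspaces (f : 'rV[R]_n -> R)
    (f_ : 'I_m -> 'rV[R]_n -> R) :
  (forall x, 0 <= f x)%R ->
  (lebesgue_rV n).-integrable [set: 'rV[R]_n] (fun x => (f x)%:E) ->
  (forall j x, x \in H j -> 0 <= f_ j x)%R ->
  (forall j, (lebesgue_sub (H j)).-integrable [set x | x \in H j]
               (fun x => (f_ j x)%:E)) ->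
  (forall (x : 'rV[R]_n) (x_ : 'I_m -> 'rV[R]_n),
    (forall j, x_ j \in H j) ->
    x = (\sum_(j < m) p j *: x_ j)%R ->
    (\prod_(j < m) f_ j (x_ j) `^ p j <= f x)%R) ->
  ((BL2 w S p)^-1)%:E *
     \prod_(j < m)
       (\int[lebesgue_sub (H j)]_(x in [set x | x \in H j]) (f_ j x)%:E)
         `^ p j
   <= \int[lebesgue_rV n]_x (f x)%:E.
Proof.
move=> f0 fint f_0 f_int ff; have [p0 _] := cover_S.
have /choice[g Hg] : forall j, exists g : 'rV[R]_n -> \bar R,
    [/\ measurable_fun setT g, forall x, 0 <= g x,
     forall x, x \in H j -> g x <= (f_ j x)%:E &
     \int[borel_lebesgue_sub (H j)]_x g x =
     \int[lebesgue_sub (H j)]_(x in [set x | x \in H j]) (f_ j x)%:E].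
  by move=> j; exact: (lebesgue_sub_envelopes (f_0 j) (f_int j)).1.
have mg j : measurable_fun setT (g j) by have [] := Hg j.
have g0 j x : 0 <= g j x by have [] := Hg j.
have [F [mF fF intF]] : exists F : 'rV[R]_n -> \bar R, [/\ measurable_fun setT F,
    forall x, (f x)%:E <= F x &
    \int[borel_lebesgue n]_x F x = \int[lebesgue_rV n]_x (f x)%:E].
  have [mf _] := integrableP _ _ _ fint.
  have foo : \int[lebesgue_rV n]_x (f x)%:E < +oo by exact: integrable_lty.
  exact: (completion_envelopes mf _ foo).2.
rewrite -intF.
have F0 x : 0 <= F x by rewrite (le_trans _ (fF x))// lee_fin.
pose h j v := g j (v *m W)%R.
have mh j : measurable_fun setT (h j).
  exact: (measurableT_comp (mg j) (measurable_mulmx _)).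
have h0 j v : 0 <= h j v by exact: g0.
have mFW : measurable_fun setT (fun v => F (v *m W)).
  exact: (measurableT_comp mF (measurable_mulmx _)).
have HW j v : (coord_proj (S j) v *m W)%R \in H j.
  rewrite mulmx_sum_row; apply: memv_suml => k _; rewrite mxE rowK.
  case: ifPn => kS; last by rewrite scale0r mem0v.
  by apply: memvZ; apply: memv_span; apply: map_f; rewrite mem_enum.
have key := @reverse_finner R m p n S h (fun v => F (v *m W)) cover_S mh h0 mFW
  (fun v => F0 _).
have {key}key : \prod_j span_int (coords (S j)) (h j) `^ p j <=
    \int[borel_lebesgue n]_v F (v *m W)%R.
  apply: key => t.
  apply: (@le_trans _ _ (\prod_j f_ j (coord_proj (S j) (t j) *m W)%R `^ p j)%:E).
    rewrite -prodEFin; apply: lee_prod => j _; rewrite -poweR_EFin poweR_ge0 andTb.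
    rewrite gt0_ler_poweR ?(ltW (p0 j))//.
    - by rewrite in_itv /= h0 leey.
    - by rewrite in_itv /= lee_fin f_0// leey.
    - by have [_ _ gf _] := Hg j; exact: gf.
  apply: le_trans (fF _); rewrite lee_fin.
  apply: (ff _ (fun j => coord_proj (S j) (t j) *m W)%R) => //.
  by rewrite mulmx_suml; apply: eq_bigr => j _; rewrite -scalemxAl.
have detW := det_family_neq0 basis_w.
have absW : (0 < `|\det W|)%R by rewrite normr_gt0.
rewrite (ge0_integral_mulmx detW mF F0).
pose c := (\prod_j wedge_norm [seq w k | k in S j] `^ p j)%R.
have c0 : (0 < c)%R.
  by apply: prodr_gt0 => j _; rewrite powR_gt0// wedge_norm_sub_gt0.
have -> : \prod_(j < m) (\int[lebesgue_sub (H j)]_(x in [set x | x \in H j])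
    (f_ j x)%:E) `^ p j = c%:E * \prod_j span_int (coords (S j)) (h j) `^ p j.
  rewrite -prod_wedge_poweR; last by move=> j; exact: span_int_ge0.
  apply: eq_bigr => j _; have [_ _ _ <-] := Hg j.
  by rewrite -(span_int_sub basis_w).
rewrite muleA -EFinM (_ : (BL2 w S p)^-1 * c = `|\det W|)%R; last first.
  by rewrite /BL2 (wedge_norm_basis basis_w) invfM invrK mulrAC mulVf ?mul1r// gt_eqF.
by rewrite lee_pmul2l.
Qed.

End main.

Theorem theorem1p3 (R : realType) (n m : nat) (w : 'I_n -> 'rV[R]_n)
    (S : 'I_m -> {set 'I_n}) (p : 'I_m -> R)
    (basis_w : basis_of fullv [seq w i | i : 'I_n])
    (m_gt0 : (0 < m)%N) (cover_S : uniform_cover S p) :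
  let H := fun j : 'I_m => <<[seq w k | k in S j]>>%VS in
  (forall f_ : 'I_m -> 'rV[R]_n -> R,
    (forall j x, x \in H j -> 0 <= f_ j x) ->
    (forall j, (lebesgue_sub (H j)).-integrable [set x | x \in H j]
                 (fun x => (f_ j x)%:E)) ->
    (\int[lebesgue_rV n]_x (\prod_(j < m) f_ j (orthoproj (H j) x) `^ p j)%:E
     <= (BL2 w S p)%:E *
        \prod_(j < m)
          (\int[lebesgue_sub (H j)]_(x in [set x | x \in H j]) (f_ j x)%:E)
            `^ p j)%E) /\
  (forall (f : 'rV[R]_n -> R) (f_ : 'I_m -> 'rV[R]_n -> R),
    (forall x, 0 <= f x) ->
    (lebesgue_rV n).-integrable [set: 'rV[R]_n] (fun x => (f x)%:E) ->
    (forall j x, x \in H j -> 0 <= f_ j x) ->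
    (forall j, (lebesgue_sub (H j)).-integrable [set x | x \in H j]
                 (fun x => (f_ j x)%:E)) ->
    (forall (x : 'rV[R]_n) (x_ : 'I_m -> 'rV[R]_n),
      (forall j, x_ j \in H j) ->
      x = \sum_(j < m) p j *: x_ j ->
      \prod_(j < m) f_ j (x_ j) `^ p j <= f x) ->
    (((BL2 w S p)^-1)%:E *
       \prod_(j < m)
         (\int[lebesgue_sub (H j)]_(x in [set x | x \in H j]) (f_ j x)%:E)
           `^ p j
     <= \int[lebesgue_rV n]_x (f x)%:E)%E).
Proof.
move=> H; split.
  exact: brascamp_lieb_subspaces basis_w cover_S.
exact: reverse_brascamp_lieb_subspaces basis_w cover_S.
Qed.
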